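(* Let ${\bm{A}}_1,\dots,{\bm{A}}_m$ be real $n\times n$ matrices such that (1) $\|{\bm{A}}_1\|_\star\le 1$ and (2) $\|{\bm{A}}_{i+1}-{\bm{A}}_i\|_\star\le\alpha$ for all $i\le m-1$. Given matrix-vector multiplication query access to the matrices, a failure rate $\delta>0$ and an error bound $\varepsilon>0$, there is a (randomized) algorithm that outputs a sequence of estimates $t_1,\dots,t_m$ such that for each $i\in[m]$, $$|t_i-\operatorname{tr}({\bm{A}}_i)|\le\varepsilon\quad\text{with probability at least }1-\delta.$$ The algorithm uses a total of $$O\!\left(m\alpha\log(m)^2\,\frac{\sqrt{\log(m/\delta)}}{\varepsilon}+m\log(m/\delta)\right)$$ matrix-vector multiplication queries to ${\bm{A}}_1,\dots,{\bm{A}}_m$.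
   Context: $\|{\bm{X}}\|_\star$ denotes the nuclear norm (sum of singular values). No norm bound is assumed on ${\bm{A}}_i$ for $i\ge 2$. The algorithm accesses each matrix only through matrix-vector products ${\bm{A}}_jx$; the estimate $t_i$ uses queries to ${\bm{A}}_1,\dots,{\bm{A}}_i$ only, and the query complexity is the total number of products.
   Formalization: Proved for δ ≤ 1 and under mα·log(m)² ≥ c for an arbitrary fixed c > 0, the O-constant depending only on c; without it (m = 1 or α → 0) the stated bound omits the cost of estimating tr(A_1) and is false for small ε. *)

(* Defs.v *)
From HB Require Import structures.
From mathcomp Require Import all_boot all_order all_algebra.
From mathcomp Require Import polyrcf.
From mathcomp Require Import all_classical all_reals all_analysis.

Set Implicit Arguments.
Unset Strict Implicit.
Unset Printing Implicit Defensive.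

Import Order.TTheory GRing.Theory Num.Theory.

Local Open Scope classical_set_scope.
Local Open Scope ring_scope.

(* Square roots of the eigenvalues of A^T A, repeated according to their
   multiplicity in the characteristic polynomial.  [rootsR] lists the distinct
   real roots; A^T A is symmetric positive semidefinite, so all its eigenvalues
   are real and nonnegative and the list has size n. *)
Definition singular_values (R : realType) (n : nat) (A : 'M[R]_n) : seq R :=
  let p := char_poly (A^T *m A) in
  flatten [seq nseq (mup x p) (Num.sqrt x) | x <- rootsR p].

Definition nuclear_norm (R : realType) (n : nat) (A : 'M[R]_n) : R :=
  \sum_(s <- singular_values A) s.

(* Deterministic adaptive online algorithm, as a decision tree, in a state where
   k estimates have been output (so the next one is that of the matrix of
   0-based index k).  In that state it may query matrices of index at most k
   only; both queries and estimates may depend on all previous answers, and it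
   stops once m estimates have been output.  Computation between the queries is
   unrestricted: only products with the matrices are counted. *)
Inductive matvec_alg (R : Type) (n m : nat) : nat -> Type :=
| Stop : matvec_alg R n m m
| Query k (j : 'I_m) (x : 'cV[R]_n) of (j <= k)%N
    & ('cV[R]_n -> matvec_alg R n m k) : matvec_alg R n m k
| Output k (t : R) of (k < m)%N & matvec_alg R n m k.+1 : matvec_alg R n m k.

Section Execution.
Context (R : realType) (n m : nat) (A : 'I_m -> 'M[R]_n).

Fixpoint outputs (k : nat) (a : matvec_alg R n m k) : seq R :=
  match a with
  | Stop => [::]
  | Query _ j x _ next => outputs (next (A j *m x))
  | Output _ t _ a' => t :: outputs a'
  end.

Fixpoint query_count (k : nat) (a : matvec_alg R n m k) : nat :=
  match a with
  | Stop => 0%N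
  | Query _ j x _ next => (query_count (next (A j *m x))).+1
  | Output _ _ _ a' => query_count a'
  end.

(* A run from state 0 outputs exactly m values (see [size_outputs]), so the
   default value of [nth] is never used. *)
Definition estimate (a : matvec_alg R n m 0) (i : 'I_m) : R :=
  nth 0 (outputs a) i.

Lemma size_outputs (k : nat) (a : matvec_alg R n m k) :
  (k + size (outputs a) = m)%N.
Proof.
elim: a => /= [|k0 j x _ next IH|k0 t _ a' IH]; first by rewrite addn0.
- exact: IH.
- by rewrite addnS -addSn.
Qed.

End Execution.

(* A random seed selects a deterministic algorithm; on every input each estimate
   has to be a random variable. *)
Record rand_matvec_alg (R : realType) (d : measure_display)
    (T : measurableType d) (n m : nat) := RandMatvecAlg {
  run_with : T -> matvec_alg R n m 0;
  measurable_estimate : forall (A : 'I_m -> 'M[R]_n) (i : 'I_m),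
    measurable_fun setT (fun w => estimate A (run_with w) i) }.

(* Main.v *)
Require Import Defs.
From HB Require Import structures.
From mathcomp Require Import all_boot all_order all_algebra.
From mathcomp Require complex.
From mathcomp Require Import polyrcf ring lra zify.
From mathcomp Require Import all_classical all_reals all_analysis.
Import Order.TTheory GRing.Theory Num.Theory.
Local Open Scope classical_set_scope.
Local Open Scope ring_scope.

Set Implicit Arguments.
Unset Strict Implicit.
Unset Printing Implicit Defensive.

(** The trace of A_i is the sum, along the chain i, i minus its lowest binary
digit, ..., 0, of the traces of the increments B of the sequence A over dyadic
intervals.  The chain has at most log m + 1 links, and the increments over
intervals of length 2^l, of which there are about m / 2^l, have nuclear norm at
most N := 2^l alpha.

The trace of one increment B is estimated in two phases.  In the first, the
direction (1 - P) B g of a random sign vector g is repeatedly adjoined to the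
range of an orthogonal projection P.  Let F be the squared Frobenius norm of
C := (1 - P) B and M := C^T C.  One step lowers F by |M g|^2 / |C g|^2, which by
the second moment method is at least |M|_F^2 / (48 F) with probability 1/24, and
F^3 <= N^2 |M|_F^2 by Hoelder's inequality for the singular values of C.  Hence
F <= 48 N^2 / k as soon as k steps have succeeded, which fails with probability
at most 2^-G after 48 (k + G) steps.  In the second phase the trace of
(1 - P) B (1 - P) is estimated by Hutchinson's estimator: a median of G means
achieves failure probability 2^-G using nothing but its variance 2 F.

The union bounds need no independence between different increments, so all of
them share one seed; the seeds are finitely many and equidistributed. *)

(** * Frobenius product and the real spectral theorem *)

Section FrobeniusProduct.
Context {R : realFieldType}.

Definition ip (m n : nat) (A B : 'M[R]_(m, n)) : R := \tr (A^T *m B).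

Definition op_contraction (n : nat) (W : 'M[R]_n) : Prop :=
  forall x : 'cV[R]_n, ip (W *m x) (W *m x) <= ip x x.

(* The dual form of [nuclear_norm A <= N]; it is manifestly subadditive in A. *)
Definition dual_le (n : nat) (A : 'M[R]_n) (N : R) : Prop :=
  forall W : 'M[R]_n, op_contraction W -> ip W A <= N.

Definition is_proj (n : nat) (P : 'M[R]_n) : Prop :=
  P^T = P /\ P *m P = P.

Lemma ipE (m n : nat) (A B : 'M[R]_(m, n)) :
  ip A B = \sum_j \sum_i A i j * B i j.
Proof. by apply: eq_bigr => j _; rewrite !mxE; apply: eq_bigr => i _; rewrite mxE. Qed.

Lemma ipC (m n : nat) (A B : 'M[R]_(m, n)) : ip A B = ip B A.
Proof. by rewrite /ip -mxtrace_tr trmx_mul trmxK. Qed.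

Lemma ipDl (m n : nat) (A B C : 'M[R]_(m, n)) : ip (A + B) C = ip A C + ip B C.
Proof. by rewrite /ip raddfD /= mulmxDl raddfD. Qed.

Lemma ipDr (m n : nat) (A B C : 'M[R]_(m, n)) : ip C (A + B) = ip C A + ip C B.
Proof. by rewrite ipC ipDl !(ipC C). Qed.

Lemma ipZl (m n : nat) (a : R) (A B : 'M[R]_(m, n)) : ip (a *: A) B = a * ip A B.
Proof. by rewrite /ip linearZ /= -scalemxAl linearZ. Qed.

Lemma ipZr (m n : nat) (a : R) (A B : 'M[R]_(m, n)) : ip A (a *: B) = a * ip A B.
Proof. by rewrite ipC ipZl ipC. Qed.

Lemma ipNl (m n : nat) (A B : 'M[R]_(m, n)) : ip (- A) B = - ip A B.
Proof. by rewrite -scaleN1r ipZl mulN1r. Qed.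

Lemma ipNr (m n : nat) (A B : 'M[R]_(m, n)) : ip A (- B) = - ip A B.
Proof. by rewrite ipC ipNl ipC. Qed.

Lemma ip0l (m n : nat) (A : 'M[R]_(m, n)) : ip 0 A = 0.
Proof. by rewrite /ip trmx0 mul0mx mxtrace0. Qed.

Lemma ip0r (m n : nat) (A : 'M[R]_(m, n)) : ip A 0 = 0.
Proof. by rewrite ipC ip0l. Qed.

Lemma ipMl (m n p : nat) (C : 'M[R]_(m, n)) (A : 'M[R]_(n, p)) (B : 'M[R]_(m, p)) :
  ip (C *m A) B = ip A (C^T *m B).
Proof. by rewrite /ip trmx_mul mulmxA. Qed.

Lemma ipMr (m n p : nat) (A : 'M[R]_(m, n)) (C : 'M[R]_(n, p)) (B : 'M[R]_(m, p)) :
  ip (A *m C) B = ip A (B *m C^T).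
Proof. by rewrite /ip trmx_mul -mulmxA mxtrace_mulC !mulmxA. Qed.

Lemma ip_ge0 (m n : nat) (A : 'M[R]_(m, n)) : 0 <= ip A A.
Proof. by rewrite ipE; do 2![apply: sumr_ge0 => ? _]; rewrite -expr2 sqr_ge0. Qed.

Lemma ip_eq0 (m n : nat) (A : 'M[R]_(m, n)) : ip A A = 0 -> A = 0.
Proof.
have nn k l : 0 <= A k l * A k l by rewrite -expr2 sqr_ge0.
rewrite ipE => /eqP; rewrite psumr_eq0; last by move=> j _; apply: sumr_ge0.
move=> /allP A0; apply/matrixP => i j; rewrite mxE; apply/eqP.
have := A0 j (mem_index_enum _); rewrite psumr_eq0 //.
by move=> /allP /(_ i (mem_index_enum _)); rewrite mulf_eq0 orbb.
Qed.

Lemma ip_CS (m n : nat) (A B : 'M[R]_(m, n)) : ip A B ^+ 2 <= ip A A * ip B B.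
Proof.
have [/ip_eq0 ->|B_neq0] := eqVneq (ip B B) 0.
  by rewrite !ip0r mulr0 expr0n.
have B_gt0 : 0 < ip B B by rewrite lt0r B_neq0 ip_ge0.
have := ip_ge0 (ip B B *: A - ip A B *: B).
rewrite !(ipDl, ipDr, ipNl, ipNr, ipZl, ipZr) (ipC B A).
move: (ip A A) (ip B B) (ip A B) B_gt0 => a b c b0 h.
by rewrite -(ler_pM2l b0); lra.
Qed.

Lemma ip_colE (m n : nat) (A B : 'M[R]_(m, n)) :
  ip A B = \sum_j ip (col j A) (col j B).
Proof.
rewrite ipE; apply: eq_bigr => j _; rewrite ipE big_ord1.
by apply: eq_bigr => i _; rewrite !mxE.
Qed.

Lemma mulmx_col (m n p : nat) (A : 'M[R]_(m, n)) (B : 'M[R]_(n, p)) (j : 'I_p) :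
  A *m col j B = col j (A *m B).
Proof. by rewrite !colE mulmxA. Qed.

Lemma ip_col (m n : nat) (A B : 'M[R]_(m, n)) (i j : 'I_n) :
  ip (col i A) (col j B) = (A^T *m B) i j.
Proof.
by rewrite /ip /mxtrace big_ord1 !mxE; apply: eq_bigr => k _; rewrite !mxE.
Qed.

Lemma is_proj0 (n : nat) : is_proj (0 : 'M[R]_n).
Proof. by split; rewrite ?trmx0 ?mul0mx. Qed.

Lemma is_projC (n : nat) (P : 'M[R]_n) : is_proj P -> is_proj (1%:M - P).
Proof.
move=> [sP iP]; split; first by rewrite linearB /= trmx1 sP.
by rewrite mulmxBr mulmx1 mulmxBl mul1mx iP subrr subr0.
Qed.

Lemma is_proj_ip (n p : nat) (P : 'M[R]_n) (A : 'M[R]_(n, p)) :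
  is_proj P -> ip (P *m A) (P *m A) <= ip A A.
Proof.
move=> hP; have [sQ iQ] := is_projC hP; have [sP iP] := hP.
have e : ip A A = ip (P *m A) (P *m A)
               + ip ((1%:M - P) *m A) ((1%:M - P) *m A).
  rewrite !ipMl !mulmxA sP iP sQ iQ -ipDr -mulmxDl.
  by rewrite addrC subrK mul1mx.
by rewrite e lerDl ip_ge0.
Qed.

Lemma dual_leD (n : nat) (A B : 'M[R]_n) (N K : R) :
  dual_le A N -> dual_le B K -> dual_le (A + B) (N + K).
Proof. by move=> hA hB W hW; rewrite ipDr lerD ?hA ?hB. Qed.

Lemma dual_le0 (n : nat) : dual_le (0 : 'M[R]_n) 0.
Proof. by move=> W _; rewrite ip0r. Qed.

(** The projection moves to the other side, [ip W (P *m A) = ip (P *m W) A], and [P *m W] is again a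
    contraction. *)
Lemma dual_le_proj (n : nat) (P A : 'M[R]_n) (N : R) :
  is_proj P -> dual_le A N -> dual_le (P *m A) N.
Proof.
move=> hP hA W hW; rewrite ipC ipMl ipC; have [-> _] := hP.
apply: hA => x; rewrite -mulmxA; exact: le_trans (is_proj_ip _ hP) (hW x).
Qed.

End FrobeniusProduct.

Section RealEigenvector.
Import complex.
Context {R : rcfType}.

(* Over R[i] the matrix is hermitian, so its eigenvalues are real. *)
Lemma symmetric_eigenvector (n : nat) (M : 'M[R]_n.+1) : M^T = M ->
  exists (x : R) (v : 'cV[R]_n.+1), v != 0 /\ M *m v = x *: v.
Proof.
move=> sM; pose f : {rmorphism R -> R[i]} := real_complex R.
pose Mc : 'M[R[i]]_n.+1 := map_mx f M.
have hM : Mc \is hermsymmx.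
  apply: spectral.realsym_hermsym.
    apply/is_hermitianmxP; rewrite expr0 scale1r map_mx_id //.
    by rewrite /Mc map_trmx sM.
  by apply/mxOverP => i j; rewrite mxE; apply/complex_realP; exists (M i j).
have /mxOverP/(_ 0 0) := spectral.hermitian_spectral_diag_real hM.
move=> /complex_realP[x dx].
have /spectral.hermitian_normalmx/spectral.orthomx_spectralP eM := hM.
have uP := spectral.spectral_unit Mc.
move: eM uP dx; set P := spectral.spectralmx Mc; set d := spectral.spectral_diag Mc.
move=> eM uP dx.
have ev : eigenvalue Mc (f x).
  apply/eigenvalueP; exists (row 0 P); last first.
    apply/eqP => r0; have : row 0 (P *m invmx P) = 0 by rewrite row_mul r0 mul0mx.
    rewrite mulmxV // => /rowP/(_ 0); rewrite !mxE eqxx => /eqP.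
    by rewrite oner_eq0.
  rewrite -row_mul {1}eM !mulmxA mulmxV // mul1mx.
  by rewrite row_mul row_diag_mx -scalemxAl -rowE dx.
move: ev; rewrite eigenvalue_root_char /Mc -map_char_poly fmorph_root.
rewrite -eigenvalue_root_char => /eigenvalueP[v vM v0].
exists x, v^T; rewrite trmx_eq0; split => //.
by rewrite -[M]sM -trmx_mul vM linearZ.
Qed.

End RealEigenvector.

Section Spectral.
Context {R : rcfType}.

(** Reflection in the hyperplane orthogonal to [w]; as division by 0 gives 0, it is the identity for
    [w = 0]. *)
Definition householder (n : nat) (w : 'cV[R]_n) : 'M[R]_n :=
  1%:M - (2 / ip w w) *: (w *m w^T).

Lemma householder_tr (n : nat) (w : 'cV[R]_n) : (householder w)^T = householder w.
Proof. by rewrite /householder linearB /= linearZ /= trmx1 trmx_mul trmxK. Qed.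

Lemma mulmx_trip (n : nat) (v w : 'cV[R]_n) : v^T *m w = (ip v w)%:M.
Proof. by rewrite /ip /mxtrace big_ord1 -mx11_scalar. Qed.

Lemma householder_mul (n : nat) (w v : 'cV[R]_n) :
  householder w *m v = v - (2 * ip w v / ip w w) *: w.
Proof.
rewrite /householder mulmxBl mul1mx -scalemxAl -mulmxA mulmx_trip.
by rewrite mul_mx_scalar scalerA; congr (_ - _ *: _); ring.
Qed.

Lemma householderK (n : nat) (w : 'cV[R]_n) :
  householder w *m householder w = 1%:M.
Proof.
rewrite {2}/householder mulmxBr mulmx1 -scalemxAr mulmxA householder_mul.
have [w0|w0] := eqVneq (ip w w) 0.
  by rewrite (ip_eq0 w0) /householder !(trmx0, mulmx0, scaler0, subr0).
have -> : w - (2 * ip w w / ip w w) *: w = - w.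
  by rewrite mulfK // scaler_nat mulr2n opprD addrA subrr add0r.
by rewrite mulNmx scalerN opprK /householder subrK.
Qed.

Lemma householder_unit (n : nat) (u v : 'cV[R]_n) :
  ip u u = 1 -> ip v v = 1 -> householder (v - u) *m u = v.
Proof.
move=> u1 v1; rewrite householder_mul.
have [/ip_eq0 w0|w0] := eqVneq (ip (v - u) (v - u)) 0.
  by rewrite w0 scaler0 subr0; apply/esym/eqP; rewrite -subr_eq0 w0.
have -> : 2 * ip (v - u) u = - ip (v - u) (v - u).
  rewrite !(ipDl, ipDr, ipNl, ipNr) u1 v1 (ipC u v); ring.
by rewrite mulNr mulfV // scaleN1r opprK addrC subrK.
Qed.

(** Induction on the dimension: a Householder reflection [H] exchanges the first basis vector with a
    unit eigenvector, so [H *m M *m H] has the eigenvalue in its corner, zeros beside it by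
    symmetry, and a smaller symmetric block. *)
Theorem symmetric_spectral (n : nat) (M : 'M[R]_n) : M^T = M ->
  exists (V : 'M[R]_n) (d : 'rV[R]_n),
    V^T *m V = 1%:M /\ M = V *m diag_mx d *m V^T.
Proof.
elim: n M => [|n IHn] M sM.
  by exists 1%:M, 0; split; apply/matrixP => -[].
have [x [v0 [v0_neq0 Mv0]]] := symmetric_eigenvector sM.
have s_gt0 : 0 < ip v0 v0.
  by rewrite lt0r ip_ge0 andbT; apply: contra_neq v0_neq0; exact: ip_eq0.
pose v := (Num.sqrt (ip v0 v0))^-1 *: v0.
have Mv : M *m v = x *: v by rewrite -scalemxAr Mv0 !scalerA mulrC.
have v1 : ip v v = 1.
  rewrite ipZl ipZr mulrA -invfM -expr2 sqr_sqrtr ?ip_ge0 // mulVf //.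
  by rewrite gt_eqF.
pose e0 : 'cV[R]_n.+1 := delta_mx 0 0.
have e01 : ip e0 e0 = 1.
  rewrite ipE big_ord1 (bigD1 0) //= big1 ?addr0 => [|i i0]; rewrite !mxE ?eqxx ?mulr1 //.
  by rewrite (negbTE i0) mul0r.
pose H := householder (v - e0).
have He : H *m e0 = v by exact: householder_unit.
have HH : H *m H = 1%:M by exact: householderK.
have Ht : H^T = H by exact: householder_tr.
have Hv : H *m v = e0 by rewrite -He mulmxA HH mul1mx.
pose M2 : 'M[R]_(1 + n) := H *m M *m H.
have sM2 : M2^T = M2 by rewrite /M2 !trmx_mul Ht sM mulmxA.
have M2e : M2 *m e0 = x *: e0 by rewrite -!mulmxA He Mv -scalemxAr Hv.
have eM : M = H *m M2 *m H by rewrite /M2 !mulmxA HH mul1mx -mulmxA HH mulmx1.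
clearbody M2.
have M2c i : M2 i (lshift n 0) = x *+ (i == lshift n 0).
  have /colP/(_ i) := M2e; rewrite -colE !mxE lshift0 => ->.
  by rewrite eqxx andbT mulr_natr.
have M2B : M2 = block_mx x%:M 0 0 (drsubmx M2).
  rewrite -[LHS](@submxK _ 1 n 1 n); congr (block_mx _ _ _ _).
  - by apply/matrixP => i j; rewrite !ord1 !mxE M2c eqxx.
  - apply/matrixP => i j; rewrite !ord1 !mxE -sM2 mxE M2c.
    by rewrite eq_rlshift.
  - by apply/matrixP => i j; rewrite !ord1 !mxE M2c eq_rlshift.
have sM' : (drsubmx M2)^T = drsubmx M2 by rewrite trmx_drsub sM2.
have [V' [d' [oV' eM']]] := IHn _ sM'.
pose B : 'M[R]_(1 + n) := block_mx 1%:M 0 0 V'.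
have BB : B^T *m B = 1%:M.
  rewrite /B tr_block_mx mulmx_block !(trmx0, mul0mx, mulmx0, trmx1, mul1mx).
  by rewrite oV' !(addr0, add0r) -scalar_mx_block.
pose D : 'rV[R]_(1 + n) := row_mx x%:M d'.
have eD : diag_mx D = block_mx (diag_mx x%:M) 0 0 (diag_mx d').
  exact: diag_mx_row.
have key : M2 = B *m diag_mx D *m B^T.
  rewrite M2B eD /B tr_block_mx !mulmx_block.
  rewrite !(trmx0, mul0mx, mulmx0, trmx1, mul1mx, mulmx1, addr0, add0r).
  rewrite -eM'; congr (block_mx _ _ _ _).
  by apply/matrixP => i j; rewrite !ord1 !mxE eqxx.
exists (H *m B), D; split.
  by rewrite trmx_mul Ht mulmxA -(mulmxA _ H H) HH mulmx1.
by rewrite eM trmx_mul Ht key !mulmxA.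
Qed.

End Spectral.

(** * The nuclear norm by duality *)

Section Gram.
Context {R : rcfType}.

Lemma gram_spectral (n : nat) (A : 'M[R]_n) :
  exists (V : 'M[R]_n) (d : 'rV[R]_n),
    [/\ V^T *m V = 1%:M, A^T *m A = V *m diag_mx d *m V^T
      & forall i, d 0 i = ip (A *m col i V) (A *m col i V)].
Proof.
have [|V [d [oV eA]]] := @symmetric_spectral R n (A^T *m A).
  by rewrite trmx_mul trmxK.
exists V, d; split => // i.
rewrite mulmx_col ip_col trmx_mul !mulmxA -(mulmxA V^T) eA.
by rewrite !mulmxA oV mul1mx -mulmxA oV mulmx1 mxE eqxx.
Qed.

(** Over polynomials, the characteristic matrix is conjugated by the constant matrix [V], which
    leaves the determinant unchanged. *)
Lemma char_poly_ortho (n : nat) (V : 'M[R]_n) (d : 'rV[R]_n) :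
  V^T *m V = 1%:M ->
  char_poly (V *m diag_mx d *m V^T) = \prod_(i < n) ('X - (d 0 i)%:P).
Proof.
move=> oV; have oV' := mulmx1C oV.
have -> : \prod_(i < n) ('X - (d 0 i)%:P) = char_poly (diag_mx d).
  rewrite char_poly_trig ?diag_mx_is_trig //.
  by apply: eq_bigr => i _; rewrite mxE eqxx.
pose W : 'M[{poly R}]_n := map_mx polyC V.
have oW : W *m W^T = 1%:M by rewrite map_trmx -map_mxM oV' map_mx1.
have -> : char_poly (V *m diag_mx d *m V^T)
  = \det (W *m char_poly_mx (diag_mx d) *m W^T).
  rewrite /char_poly; congr (\det _); rewrite /char_poly_mx !map_mxM /=.
  by rewrite mulmxBr mulmxBl mul_mx_scalar -scalemxAl oW scalemx1 map_trmx.
by rewrite !det_mulmx mulrAC -det_mulmx oW det1 mul1r.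
Qed.

(* The contraction is the partial isometry of the polar decomposition of A. *)
Lemma polar_contraction (n : nat) (A V : 'M[R]_n) (d : 'rV[R]_n) :
  V^T *m V = 1%:M -> A^T *m A = V *m diag_mx d *m V^T ->
  (forall i, 0 <= d 0 i) ->
  exists2 W : 'M[R]_n, op_contraction W & ip W A = \sum_i Num.sqrt (d 0 i).
Proof.
move=> oV eA d0; have oV' := mulmx1C oV.
(* The witness is [A] times the inverse square root of [A^T *m A]. Since the inverse of 0 is 0, this
   is a pseudo-inverse, and the zero eigenvalues are treated apart below. *)
pose e : 'rV[R]_n := \row_i (Num.sqrt (d 0 i))^-1.
have etr : (V *m diag_mx e *m V^T)^T = V *m diag_mx e *m V^T.
  by rewrite !trmx_mul trmxK tr_diag_mx mulmxA.
exists (A *m (V *m diag_mx e *m V^T)) => [x|].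
  have Ay y : ip (A *m y) (A *m y) = ip (diag_mx d *m (V^T *m y)) (V^T *m y).
    by rewrite ipMl (mulmxA A^T) eA [RHS]ipC [RHS]ipMl trmxK !mulmxA.
  rewrite -(mulmxA A) Ay; set y := _ *m x.
  have -> : V^T *m y = diag_mx e *m (V^T *m x).
    by rewrite /y !mulmxA oV mul1mx.
  have -> : ip x x = ip (V^T *m x) (V^T *m x).
    by rewrite ipMl trmxK mulmxA oV' mul1mx.
  move: (V^T *m x) => z; rewrite !ipE; apply: ler_sum => j _; apply: ler_sum => i _.
  rewrite !mul_diag_mx !mxE; have := d0 i; set t := d 0 i => t0.
  have := sqr_sqrtr t0; move: (Num.sqrt t) => r; have [->|r0] := eqVneq r 0 => <-.
    by rewrite !(invr0, mul0r, mulr0) -expr2 sqr_ge0.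
  by rewrite le_eqVlt; apply/orP; left; apply/eqP; field.
rewrite ipMl eA ipMr trmxK -(mulmxA _ V^T V) oV mulmx1 ipMl mulmxA oV mul1mx.
rewrite /ip tr_diag_mx mulmx_diag mxtrace_diag; apply: eq_bigr => i _.
rewrite !mxE; have := d0 i; set t := d 0 i => t0.
have := sqr_sqrtr t0; move: (Num.sqrt t) => r; have [->|r0] := eqVneq r 0 => <-.
  by rewrite invr0 mul0r.
by field.
Qed.

Lemma sum_CS (n : nat) (a b : 'I_n -> R) :
  (\sum_i a i * b i) ^+ 2 <= (\sum_i a i ^+ 2) * (\sum_i b i ^+ 2).
Proof.
have := ip_CS (\row_i a i) (\row_i b i).
rewrite !ipE; congr (_ ^+ 2 <= _ * _); apply: eq_bigr => i _;
by rewrite big_ord1 !mxE ?expr2.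
Qed.

(** Write F, N, G for the three sums from left to right and S for the sum of the powers 3/2 of the
    [d i]. Cauchy-Schwarz gives F^2 <= N S and S^2 <= F G, hence F^4 <= N^2 F G. Fourth roots [x i]
    make all exponents integral. *)
Lemma sum_sqrt_holder (n : nat) (d : 'I_n -> R) : (forall i, 0 <= d i) ->
  (\sum_i d i) ^+ 3 <= (\sum_i Num.sqrt (d i)) ^+ 2 * \sum_i d i ^+ 2.
Proof.
move=> d0; pose x i := Num.sqrt (Num.sqrt (d i)).
have x2 i : Num.sqrt (d i) = x i ^+ 2 by rewrite sqr_sqrtr ?sqrtr_ge0.
have x4 i : d i = x i ^+ 4 by rewrite -(sqr_sqrtr (d0 i)) x2 -exprM.
have h1 := sum_CS x (fun i => x i ^+ 3).
have h2 := sum_CS (fun i => x i ^+ 2) (fun i => x i ^+ 4).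
have eF : \sum_i d i = \sum_i x i * x i ^+ 3.
  by apply: eq_bigr => i _; rewrite x4 -exprS.
have eF' : \sum_i d i = \sum_i (x i ^+ 2) ^+ 2.
  by apply: eq_bigr => i _; rewrite x4 -exprM.
have eN : \sum_i Num.sqrt (d i) = \sum_i x i ^+ 2 by apply: eq_bigr.
have eG : \sum_i d i ^+ 2 = \sum_i (x i ^+ 4) ^+ 2.
  by apply: eq_bigr => i _; rewrite x4.
have eS : \sum_i x i ^+ 2 * x i ^+ 4 = \sum_i (x i ^+ 3) ^+ 2.
  by apply: eq_bigr => i _; rewrite -exprD -exprM.
move: h1 h2; rewrite -eF -eN -eG -eF' -eS.
have F0 : 0 <= \sum_i d i by apply: sumr_ge0.
have N0 : 0 <= \sum_i Num.sqrt (d i) by apply: sumr_ge0 => i _; exact: sqrtr_ge0.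
have G0 : 0 <= \sum_i d i ^+ 2 by apply: sumr_ge0 => i _; exact: sqr_ge0.
move: (\sum_i d i) (\sum_i Num.sqrt (d i)) (\sum_i d i ^+ 2) (\sum_i _ * _) F0 N0 G0.
move=> F N G S F0 N0 G0 h1 h2.
have [->|F_neq0] := eqVneq F 0.
  by rewrite expr0n /= mulr_ge0 ?sqr_ge0.
have F_gt0 : 0 < F by rewrite lt0r F_neq0.
rewrite -(ler_pM2l F_gt0).
have h3 : (F ^+ 2) ^+ 2 <= (N * S) ^+ 2.
  by rewrite ler_sqr ?nnegrE ?sqr_ge0 // (le_trans _ h1) ?sqr_ge0.
apply: (@le_trans _ _ (N ^+ 2 * S ^+ 2)).
  by rewrite -exprMn -exprS (_ : 4 = 2 * 2)%N // exprM.
have := ler_wpM2l (sqr_ge0 N) h2; congr (_ <= _); ring.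
Qed.

(** Testing [dual_le] on the polar contraction bounds the sum of the singular values by [N]; the
    rest is the preceding inequality for their squares. *)
Lemma dual_le_schatten (n : nat) (A : 'M[R]_n) (N : R) : dual_le A N ->
  ip A A ^+ 3 <= N ^+ 2 * ip (A^T *m A) (A^T *m A).
Proof.
move=> hN; have [V [d [oV eA dE]]] := gram_spectral A.
have d0 i : 0 <= d 0 i by rewrite dE ip_ge0.
have [W hW eW] := polar_contraction oV eA d0.
have -> : ip A A = \sum_i d 0 i.
  by rewrite /ip eA mxtrace_mulC mulmxA oV mul1mx mxtrace_diag.
have -> : ip (A^T *m A) (A^T *m A) = \sum_i d 0 i ^+ 2.
  rewrite eA ipMr trmxK -(mulmxA _ V^T V) oV mulmx1 ipMl mulmxA oV mul1mx.
  rewrite /ip tr_diag_mx mulmx_diag mxtrace_diag.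
  by apply: eq_bigr => i _; rewrite mxE expr2.
apply: le_trans (sum_sqrt_holder d0) _.
apply: ler_wpM2r; first by apply: sumr_ge0 => i _; exact: sqr_ge0.
have s0 : 0 <= \sum_i Num.sqrt (d 0 i) by apply: sumr_ge0 => i _; exact: sqrtr_ge0.
have sN : \sum_i Num.sqrt (d 0 i) <= N by rewrite -eW; apply: hN.
by rewrite ler_sqr ?nnegrE // (le_trans s0).
Qed.

End Gram.

Section NuclearNorm.
Context {R : realType}.

(** The characteristic polynomial splits with roots [d 0 i], so repeating each distinct root
    according to its multiplicity recovers the list of the [d 0 i] up to order. *)
Lemma nuclear_normE (n : nat) (A V : 'M[R]_n) (d : 'rV[R]_n) :
  V^T *m V = 1%:M -> A^T *m A = V *m diag_mx d *m V^T ->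
  nuclear_norm A = \sum_i Num.sqrt (d 0 i).
Proof.
move=> oV eA; rewrite /nuclear_norm /singular_values eA char_poly_ortho //.
pose s := [seq d 0 i | i <- index_enum 'I_n].
have -> : \prod_(i < n) ('X - (d 0 i)%:P) = \prod_(y <- s) ('X - y%:P).
  by rewrite big_map.
set p := (\prod_(y <- s) _).
have p0 : p != 0 by rewrite monic_neq0 // monic_prod_XsubC.
have -> : [seq nseq (mup x p) (Num.sqrt x) | x <- rootsR p]
  = [seq [seq Num.sqrt y | y <- t] | t <- [seq nseq (count_mem x s) x | x <- rootsR p]].
  by rewrite -map_comp; apply: eq_map => x /=; rewrite map_nseq mu_prod_XsubC.
rewrite -map_flatten big_map.
have pm : perm_eq (rootsR p) (undup s).
  apply: uniq_perm; rewrite ?undup_uniq ?uniq_roots // => x.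
  rewrite mem_undup -[RHS]root_prod_XsubC -/p.
  by have := roots_on_rootsR p0 x; rewrite in_itv /= => <-.
have -> : \sum_i Num.sqrt (d 0 i) = \sum_(y <- s) Num.sqrt y by rewrite big_map.
apply: perm_big; apply: perm_trans (perm_count_undup s).
by apply: perm_flatten; apply: perm_map.
Qed.

(** In an orthonormal eigenbasis [V] of [A^T *m A], Cauchy-Schwarz bounds the contribution of each
    column by |W v| |A v|, where |W v| <= 1 and |A v| is a singular value. *)
Lemma nuclear_norm_dual (n : nat) (A : 'M[R]_n) (N : R) :
  nuclear_norm A <= N -> dual_le A N.
Proof.
have [V [d [oV eA dE]]] := gram_spectral A.
rewrite (nuclear_normE oV eA) => h W hW; apply: le_trans h.
have -> : ip W A = ip (W *m V) (A *m V).
  by rewrite ipMr -mulmxA (mulmx1C oV) mulmx1.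
rewrite ip_colE; apply: ler_sum => i _; rewrite -!mulmx_col.
apply: le_trans (ler_norm _) _; rewrite -sqrtr_sqr ler_wsqrtr //.
apply: le_trans (ip_CS _ _) _; rewrite dE ler_piMl ?ip_ge0 //.
by apply: le_trans (hW _) _; rewrite ip_col oV mxE eqxx.
Qed.

End NuclearNorm.

(** * Averages over random sign vectors *)

Section Average.
Context {R : realFieldType} {T : finType}.
Implicit Types (f g : T -> R) (h : seq T -> R).

Definition avg f : R := (\sum_t f t) / #|T|%:R.

Lemma eq_avg f g : f =1 g -> avg f = avg g.
Proof. by move=> fg; congr (_ / _); apply: eq_bigr. Qed.

Lemma avgD f g : avg (fun t => f t + g t) = avg f + avg g.
Proof. by rewrite /avg big_split mulrDl. Qed.

Lemma avgZ (a : R) f : avg (fun t => a * f t) = a * avg f.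
Proof. by rewrite /avg -mulr_sumr mulrA. Qed.

Lemma avg_sum (I : finType) (P : pred I) (f : I -> T -> R) :
  avg (fun t => \sum_(i | P i) f i t) = \sum_(i | P i) avg (f i).
Proof. by rewrite /avg exchange_big mulr_suml. Qed.

Lemma ler_avg f g : (forall t, f t <= g t) -> avg f <= avg g.
Proof. by move=> fg; rewrite ler_wpM2r ?invr_ge0 // ler_sum. Qed.

Lemma avg_anti (u : T -> T) f :
  involutive u -> (forall t, f (u t) = - f t) -> avg f = 0.
Proof.
move=> uK fu; suff s0 : \sum_t f t = 0 by rewrite /avg s0 mul0r.
have : \sum_t f t = - \sum_t f t.
  rewrite {1}(reindex_inj (inv_inj uK)) /= -sumrN.
  by apply: eq_bigr => t _; exact: fu.
lra.
Qed.

(** Expectation over [L] independent uniform letters. Recursion on the first letter turns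
    conditioning on a prefix into computation. *)
Fixpoint seqE (L : nat) h : R :=
  if L is L'.+1 then avg (fun v => seqE L' (fun s => h (v :: s))) else h [::].

Lemma eq_seqE (L : nat) h1 h2 :
  (forall s, size s = L -> h1 s = h2 s) -> seqE L h1 = seqE L h2.
Proof.
elim: L h1 h2 => [|L IH] h1 h2 hh /=; first exact: hh.
by apply: eq_avg => v; apply: IH => s sL; apply: hh; rewrite /= sL.
Qed.

Lemma ler_seqE (L : nat) h1 h2 :
  (forall s, size s = L -> h1 s <= h2 s) -> seqE L h1 <= seqE L h2.
Proof.
elim: L h1 h2 => [|L IH] h1 h2 hh /=; first exact: hh.
by apply: ler_avg => v; apply: IH => s sL; apply: hh; rewrite /= sL.
Qed.

Lemma seqED (L : nat) h1 h2 :
  seqE L (fun s => h1 s + h2 s) = seqE L h1 + seqE L h2.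
Proof.
elim: L h1 h2 => [|L IH] h1 h2 //=.
by rewrite -avgD; apply: eq_avg => v; rewrite IH.
Qed.

Lemma seqEZ (L : nat) (a : R) h : seqE L (fun s => a * h s) = a * seqE L h.
Proof.
elim: L h => [|L IH] h //=.
by rewrite -avgZ; apply: eq_avg => v; rewrite IH.
Qed.

Lemma seqE_cat (L K : nat) h :
  seqE (L + K) h = seqE L (fun s => seqE K (fun t => h (s ++ t))).
Proof. by elim: L h => [|L IH] h //=; apply: eq_avg => v; rewrite IH. Qed.

Lemma seqE_tuple (L : nat) h :
  seqE L h = (\sum_(t : L.-tuple T) h t) / (#|T| ^ L)%:R.
Proof.
elim: L h => [|L IH] h /=.
  rewrite (big_pred1 [tuple]) /= ?divr1 // => t.
  by apply/esym/eqP; rewrite [t]tuple0.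
rewrite (eq_avg (fun v => IH _)) /avg.
rewrite -mulr_suml -mulrA expnSr natrM invfM; congr (_ * _).
rewrite pair_big /=.
rewrite (reindex (fun p : T * L.-tuple T => [tuple of p.1 :: p.2])) //=.
exists (fun t : L.+1.-tuple T => (thead t, [tuple of behead t])) => [[v t] _|t _] /=.
  by congr pair; apply/val_inj.
by rewrite -tuple_eta.
Qed.

Hypothesis T_gt0 : (0 < #|T|)%N.

Lemma avg_cst (a : R) : avg (fun=> a) = a.
Proof. by rewrite /avg sumr_const -(mulr_natr a) mulfK // pnatr_eq0 -lt0n. Qed.

Lemma seqE_cst (L : nat) (a : R) : seqE L (fun=> a) = a.
Proof. by elim: L => [|L IH] //=; under eq_avg do rewrite IH; rewrite avg_cst. Qed.

End Average.

Section SignVectors.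
Context {R : realFieldType} {n : nat}.
Implicit Types (g : {ffun 'I_n -> bool}) (A : 'M[R]_n).

Definition signs g : 'cV[R]_n := \col_i (-1) ^+ g i.

Lemma signsE g i : signs g i 0 = (-1) ^+ g i.
Proof. by rewrite mxE. Qed.

Lemma signs_sqr g i : signs g i 0 * signs g i 0 = 1.
Proof. by rewrite signsE -expr2 sqrr_sign. Qed.

Definition flip (a : 'I_n) g : {ffun 'I_n -> bool} := [ffun i => (i == a) (+) g i].

Lemma flipK a : involutive (flip a).
Proof. by move=> g; apply/ffunP => i; rewrite !ffunE addbA addbb. Qed.

Lemma signs_flip a g i : signs (flip a g) i 0 = (-1) ^+ (i == a) * signs g i 0.
Proof. by rewrite !signsE ffunE signr_addb. Qed.

Lemma card_signs_gt0 : (0 < #|{ffun 'I_n -> bool}|)%N.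
Proof. by apply/card_gt0P; exists [ffun=> true]. Qed.

Definition chi (p : 'I_n * 'I_n) g : R := signs g p.1 0 * signs g p.2 0.

Lemma avg_chi p : p.1 != p.2 -> avg (chi p) = 0.
Proof.
move=> p12; apply: (avg_anti (flipK p.1)) => g.
by rewrite /chi !signs_flip eqxx (eq_sym p.2) (negbTE p12); ring.
Qed.

(** Flipping the sign at an index that occurs an odd number of times among the four negates the
    product, so the average vanishes; if no such index exists, the two pairs agree up to order and
    the product is 1. *)
Lemma avg_chi2 p r : p.1 != p.2 -> r.1 != r.2 ->
  avg (fun g => chi p g * chi r g) = (r == p)%:R + (r == (p.2, p.1))%:R.
Proof.
case: p r => [i j] [k l] /= ij kl; rewrite !xpair_eqE.
have z a : odd ((i == a) + (j == a) + (k == a) + (l == a)) ->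
    avg (fun g => chi (i, j) g * chi (k, l) g) = 0.
  move=> odd_a; apply: (avg_anti (flipK a)) => g; rewrite /chi !signs_flip /=.
  have e : (-1) ^+ (i == a) * (-1) ^+ (j == a) * (-1) ^+ (k == a) * (-1) ^+ (l == a)
      = -1 :> R by rewrite -!exprD -signr_odd odd_a.
  rewrite -[RHS]mulN1r -[in RHS]e; ring.
have s2 := signs_sqr.
have [ki|ki] := eqVneq k i; have [lj|lj] := eqVneq l j => /=.
- rewrite ki (negbTE ij) addr0 -[RHS](avg_cst card_signs_gt0).
  by apply: eq_avg => g; rewrite /chi /= lj mulrACA !s2 mulr1.
- subst k; rewrite (z j); first by rewrite (negbTE ij) addr0.
  by rewrite eqxx (negbTE ij) (negbTE lj).
- subst l; rewrite (z i); first by rewrite (negbTE kl) addr0.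
  by rewrite eqxx eq_sym (negbTE ij) (negbTE ki).
have [kj|kj] := eqVneq k j; have [li|li] := eqVneq l i => /=.
- rewrite add0r -[RHS](avg_cst card_signs_gt0).
  apply: eq_avg => g; rewrite /chi /= kj li (mulrC (signs g j 0)).
  by rewrite mulrACA !s2 mulr1.
- by rewrite addr0 (z i) // eqxx eq_sym (negbTE ij) (negbTE ki) (negbTE li).
- by rewrite addr0 (z j) // eqxx (negbTE ij) (negbTE kj) (negbTE lj).
by rewrite addr0 (z i) // eqxx eq_sym (negbTE ij) (negbTE ki) (negbTE li).
Qed.

Definition quad A g : R := ip (signs g) (A *m signs g).

Lemma quadE A g :
  quad A g = \tr A + \sum_(p : 'I_n * 'I_n | p.1 != p.2) A p.1 p.2 * chi p g.
Proof.
have -> : quad A g = \sum_(p : 'I_n * 'I_n) A p.1 p.2 * chi p g.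
  rewrite /quad ipE big_ord1 -(pair_bigA _ (fun i j => A i j * chi (i, j) g)) /=.
  apply: eq_bigr => i _; rewrite [(A *m _) _ _]mxE mulr_sumr; apply: eq_bigr => j _.
  by rewrite /chi /=; ring.
rewrite (bigID (fun p : 'I_n * 'I_n => p.1 != p.2)) /= addrC; congr (_ + _).
rewrite -(pair_big_dep xpredT (fun i j => ~~ (i != j))
  (fun i j => A i j * chi (i, j) g)) /=.
apply: eq_bigr => i _; rewrite (big_pred1 i) => [|j].
  by rewrite /chi /= signs_sqr mulr1.
by rewrite negbK eq_sym.
Qed.

Lemma avg_quad A : avg (quad A) = \tr A.
Proof.
under eq_avg do rewrite quadE; rewrite avgD avg_cst ?card_signs_gt0 // avg_sum.
by rewrite big1 ?addr0 // => p p12; rewrite avgZ avg_chi // mulr0.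
Qed.

(** The diagonal contributes the constant trace because squared signs are 1; orthogonality of the
    off-diagonal products [chi] leaves the sum of a (a + b) over mirrored entries a and b. *)
Lemma avg_quad_var A : avg (fun g => (quad A g - \tr A) ^+ 2) <= 2 * ip A A.
Proof.
have -> : avg (fun g => (quad A g - \tr A) ^+ 2) =
  \sum_(p : 'I_n * 'I_n | p.1 != p.2) A p.1 p.2 * (A p.1 p.2 + A p.2 p.1).
  under eq_avg => g.
    rewrite quadE addrC addKr expr2 mulr_suml; under eq_bigr do rewrite mulr_sumr.
    over.
  rewrite avg_sum; apply: eq_bigr => p p12; rewrite avg_sum.
  have h r : r.1 != r.2 ->
    avg (fun g => A p.1 p.2 * chi p g * (A r.1 r.2 * chi r g)) =
    A p.1 p.2 * (A r.1 r.2 * (r == p)%:R + A r.1 r.2 * (r == (p.2, p.1))%:R).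
    move=> r12; rewrite -mulrDr -(avg_chi2 p12 r12) -!avgZ.
    by apply: eq_avg => g; ring.
  rewrite (eq_bigr _ h) -mulr_sumr big_split /=; congr (_ * (_ + _)).
    rewrite (bigD1 p) //= eqxx mulr1 big1 ?addr0 // => r /andP[_ /negbTE ->].
    by rewrite mulr0.
  have p21 : p.2 != p.1 by rewrite eq_sym.
  rewrite (bigD1 (p.2, p.1)) //= eqxx mulr1 big1 ?addr0 // => r /andP[_ /negbTE ->].
  by rewrite mulr0.
have e : ip A A = \sum_(p : 'I_n * 'I_n) A p.1 p.2 ^+ 2.
  rewrite ipE exchange_big -(pair_bigA _ (fun i j => A i j ^+ 2)) /=.
  by apply: eq_bigr => i _; apply: eq_bigr => j _; rewrite expr2.
have e' : ip A A = \sum_(p : 'I_n * 'I_n) A p.2 p.1 ^+ 2.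
  by rewrite ipE -(pair_bigA _ (fun i j => A j i ^+ 2)).
(* The weights come from a (a + b) <= 3/2 a^2 + 1/2 b^2; summed over all positions they add up to
   2. *)
apply: (@le_trans _ _ (\sum_(p : 'I_n * 'I_n)
    (3 / 2 * A p.1 p.2 ^+ 2 + 1 / 2 * A p.2 p.1 ^+ 2))); last first.
  by rewrite big_split -!mulr_sumr -e -e' /=; lra.
rewrite big_mkcond /=; apply: ler_sum => p _.
move: (A p.1 p.2) (A p.2 p.1) => a b.
have := sqr_ge0 (a - b); have := sqr_ge0 a; have := sqr_ge0 b.
by case: ifP => _; lra.
Qed.

Lemma ip_gram_le (m : nat) (C : 'M[R]_(m, n)) :
  ip (C^T *m C) (C^T *m C) <= ip C C ^+ 2.
Proof.
have -> : ip C C ^+ 2 = \sum_i ip (col i C) (col i C) * ip C C.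
  by rewrite expr2 {1}ip_colE mulr_suml.
rewrite ipE exchange_big /=.
apply: ler_sum => i _; rewrite (ip_colE C) mulr_sumr; apply: ler_sum => j _.
by rewrite -!ip_col -expr2 ip_CS.
Qed.

Lemma quad_gram (m : nat) (C : 'M[R]_(m, n)) g :
  quad (C^T *m C) g = ip (C *m signs g) (C *m signs g).
Proof. by rewrite /quad -mulmxA -ipMl. Qed.

Lemma avg_gram (m : nat) (C : 'M[R]_(m, n)) :
  avg (fun g => ip (C *m signs g) (C *m signs g)) = ip C C.
Proof. by under eq_avg do rewrite -quad_gram; rewrite avg_quad. Qed.

(** Second moment as variance plus squared mean; the variance is at most twice the squared norm of
    the Gram matrix, hence at most twice [ip C C ^+ 2]. *)
Lemma avg_gram_sqr (m : nat) (C : 'M[R]_(m, n)) :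
  avg (fun g => ip (C *m signs g) (C *m signs g) ^+ 2) <= 3 * ip C C ^+ 2.
Proof.
have := avg_quad_var (C^T *m C); have := ip_gram_le C.
have -> : avg (fun g => ip (C *m signs g) (C *m signs g) ^+ 2)
  = avg (fun g => (quad (C^T *m C) g - ip C C) ^+ 2) + ip C C ^+ 2.
  rewrite [X in _ + X](_ : _ =
    avg (fun g => 2 * ip C C * quad (C^T *m C) g + - ip C C ^+ 2)); last first.
    rewrite avgD avgZ avg_quad avg_cst ?card_signs_gt0 // /ip; ring.
  by rewrite -avgD; apply: eq_avg => g; rewrite -quad_gram; ring.
rewrite -/(ip C C); lra.
Qed.

(* Second moment method for |Mg|^2, Markov's inequality for |Cg|^2. *)
Lemma gram_step_prob (C : 'M[R]_n) (M := C^T *m C) : 0 < ip C C ->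
  1 / 24 <= avg (fun g =>
    ((ip M M / 2 <= ip (M *m signs g) (M *m signs g)) &&
     (ip (C *m signs g) (C *m signs g) <= 24 * ip C C))%:R : R).
Proof.
move=> C0; set mu := ip M M.
have mu0 : 0 < mu.
  rewrite lt0r ip_ge0 andbT; apply/eqP => /ip_eq0 M0.
  by move: C0; rewrite /ip -/M M0 mxtrace0 ltxx.
pose Z g := ip (M *m signs g) (M *m signs g).
pose W g := ip (C *m signs g) (C *m signs g).
pose a := (6 * mu)^-1.
have a0 : 0 < a by rewrite invr_gt0 mulr_gt0.
have amu : a * mu = 1 / 6 by rewrite /a; field; rewrite gt_eqF.
pose F := ip C C; have F0 : 0 < F by [].
(* The indicator dominates 2aZ - (aZ)^2 - a mu - W/(24F): the first two terms are at most 1, they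
   are at most a mu when Z < mu/2, and the last is below -1 when W > 24F. The average is at least a
   mu - 3 (a mu)^2 - 1/24, whose maximum 1/24 is attained at a mu = 1/6. *)
apply: (@le_trans _ _ (avg (fun g =>
  2 * a * Z g + (- (a * mu) + (- a ^+ 2 * Z g ^+ 2 + - (24 * F)^-1 * W g))))).
  rewrite !avgD !avgZ avg_cst ?card_signs_gt0 //.
  have := avg_gram_sqr M; rewrite -/mu => h.
  have := ler_wpM2l (sqr_ge0 a) h.
  rewrite /Z /W !avg_gram -/mu -/F => {}h.
  have -> : - (24 * F)^-1 * F = - (1 / 24) by field; rewrite gt_eqF.
  have : a ^+ 2 * (3 * mu ^+ 2) = 3 * (a * mu) ^+ 2 by ring.
  rewrite amu; nra.
apply: ler_avg => g; rewrite -/(Z g) -/(W g) -/F.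
have Z0 : 0 <= Z g := ip_ge0 _; have W0 : 0 <= W g := ip_ge0 _.
have v0 : 0 < (24 * F)^-1 by rewrite invr_gt0 mulr_gt0.
have vW0 : 0 <= (24 * F)^-1 * W g by rewrite mulr_ge0 // ltW.
case: (leP (mu / 2) (Z g)) => hZ /=; last first.
  have : 0 <= a ^+ 2 * Z g ^+ 2 by rewrite mulr_ge0 ?sqr_ge0.
  have : a * Z g < a * (mu / 2) by rewrite ltr_pM2l.
  lra.
case: (leP (W g) (24 * F)) => hW /=.
  have : 0 <= (a * Z g - 1) ^+ 2 by exact: sqr_ge0.
  have : 0 <= a * mu by rewrite amu.
  nra.
have : 1 < (24 * F)^-1 * W g by rewrite mulrC ltr_pdivlMr ?mulr_gt0 // mul1r.
have : 0 <= (a * Z g - 1) ^+ 2 by exact: sqr_ge0.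
have : 0 <= a * mu by rewrite amu.
nra.
Qed.

End SignVectors.

(** * Median of means and deflation *)

Section MedianOfMeans.
Context {R : realFieldType}.

Fixpoint group_means (G s : nat) (xs : seq R) : seq R :=
  if G is G'.+1
  then (\sum_(x <- take s xs) x) / s%:R :: group_means G' s (drop s xs)
  else [::].

Lemma size_group_means (G s : nat) (xs : seq R) : size (group_means G s xs) = G.
Proof. by elim: G xs => [|G IH] xs //=; rewrite IH. Qed.

Definition far (tau mu : R) : pred R := fun x => tau < `|x - mu|.

(* Plays the role of the median: a number close to more than half of the xs. *)
Definition majority_center (tau : R) (xs : seq R) : R :=
  xget 0 [set t | (size xs < 2 * count (predC (far tau t)) xs)%N].

(** The value [mu] itself qualifies, so the default of [xget] is never taken. Two strict majorities
    share an element, which lies within [tau] of both centers. *)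
Lemma majority_centerP (tau mu : R) (xs : seq R) :
  (2 * count (far tau mu) xs < size xs)%N ->
  `|majority_center tau xs - mu| <= 2 * tau.
Proof.
move=> few_bad.
have many_good : (size xs < 2 * count (predC (far tau mu)) xs)%N.
  by have := count_predC (far tau mu) xs; lia.
have /= := @xgetPex _ 0 [set t | (size xs < 2 * count (predC (far tau t)) xs)%N]
  (ex_intro _ mu many_good).
rewrite -/(majority_center tau xs); set t := majority_center tau xs => many_t.
have : has (predI (predC (far tau t)) (predC (far tau mu))) xs.
  rewrite has_count; have := count_predUI (predC (far tau t)) (predC (far tau mu)) xs.
  by have := count_size (predU (predC (far tau t)) (predC (far tau mu))) xs; lia.
move=> /hasP[x _ /= /andP[]]; rewrite /far -!leNgt !ler_norml; lra.
Qed.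

Context {T : finType} (T_gt0 : (0 < #|T|)%N).
Variables (f : T -> R) (mu v tau : R).
Hypotheses (avg_f : avg f = mu) (var_f : avg (fun t => (f t - mu) ^+ 2) <= v).

(** The offset [a] carries the letters already drawn through the induction; its cross term with the
    next letter averages to zero. *)
Lemma seqE_sqr_sum (s : nat) (a : R) :
  seqE s (fun w => (a + \sum_(x <- w) (f x - mu)) ^+ 2) <= a ^+ 2 + s%:R * v.
Proof.
elim: s a => [|s IH] a /=; first by rewrite big_nil addr0 mul0r addr0.
apply: (@le_trans _ _ (avg (fun x => (f x - mu) ^+ 2 +
    (2 * a * f x + (a ^+ 2 - 2 * a * mu + s%:R * v))))).
  apply: ler_avg => x.
  apply: (@le_trans _ _ ((a + (f x - mu)) ^+ 2 + s%:R * v)); last first.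
    by rewrite le_eqVlt; apply/orP; left; apply/eqP; ring.
  apply: le_trans (IH _); apply: ler_seqE => w _.
  by rewrite big_cons addrA.
rewrite 2!avgD avgZ avg_f avg_cst // -(natr1 s).
apply: le_trans (lerD var_f (lexx _)) _; lra.
Qed.

Hypothesis tau_gt0 : 0 < tau.

(** Chebyshev's inequality for the mean of [s] samples. *)
Lemma seqE_mean_bad (s : nat) : (0 < s)%N -> 16 * v <= s%:R * tau ^+ 2 ->
  seqE s (fun w => (far tau mu ((\sum_(x <- map f w) x) / s%:R))%:R : R) <= 1 / 16.
Proof.
move=> s0 sv; have s0' : 0 < s%:R :> R by rewrite ltr0n.
pose D := (s%:R * tau) ^+ 2; have D0 : 0 < D by rewrite exprn_gt0 // mulr_gt0.
apply: (@le_trans _ _ (seqE s (fun w => D^-1 * (0 + \sum_(x <- w) (f x - mu)) ^+ 2))).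
  apply: ler_seqE => w ws; rewrite add0r.
  have -> : \sum_(x <- w) (f x - mu) = s%:R * ((\sum_(x <- map f w) x) / s%:R - mu).
    rewrite big_map mulrBr mulrC divfK ?gt_eqF // sumrB; congr (_ - _).
    by rewrite big_const_seq count_predT ws iter_addr_0 mulr_natl.
  rewrite /far; move: ((\sum_(x <- map f w) x) / s%:R - mu) => y.
  case: ltP => [hy|_]; last by rewrite mulr_ge0 ?invr_ge0 ?sqr_ge0 ?ltW.
  rewrite mulrC ler_pdivlMr // mul1r /D !exprMn ler_pM2l ?exprn_gt0 //.
  by rewrite -[y ^+ 2]ger0_norm ?sqr_ge0 // normrX ler_sqr ?nnegrE ?normr_ge0 ?ltW.
rewrite seqEZ mulrC ler_pdivrMr //.
apply: le_trans (seqE_sqr_sum s 0) _; rewrite expr0n /= add0r /D.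
have := ler_wpM2l (ltW s0') sv; nra.
Qed.

(** Chernoff's method with base 16: each group multiplies the exponential moment by at most 1 +
    15/16 <= 2, while at least G/2 bad groups make the power at least 4^G. Markov's inequality gives
    2^G / 4^G. *)
Lemma seqE_many_bad (G s : nat) : (0 < s)%N -> 16 * v <= s%:R * tau ^+ 2 ->
  seqE (G * s) (fun w => (G <=
    2 * count (far tau mu) (group_means G s (map f w)))%N%:R : R)
  <= 2 ^- G.
Proof.
move=> s0 sv; pose bad := far tau mu.
have mgf H : seqE (H * s) (fun w => 16 ^+ count bad (group_means H s (map f w)) : R)
    <= 2 ^+ H.
  elim: H => [|H IH] //=; rewrite mulSn seqE_cat.
  apply: (@le_trans _ _ (seqE s (fun w => 2 ^+ H *
      (1 + 15 * (bad ((\sum_(x <- map f w) x) / s%:R))%:R)))).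
    apply: ler_seqE => w ws.
    rewrite (@eq_seqE _ _ _ _ (fun u => 16 ^+ bad ((\sum_(x <- map f w) x) / s%:R) *
        16 ^+ count bad (group_means H s (map f u)))); last first.
      move=> u _; rewrite map_cat take_size_cat ?drop_size_cat ?size_map //.
      by rewrite exprD.
    rewrite seqEZ mulrC; apply: ler_pM => //.
    - by rewrite -(seqE_cst T_gt0 (H * s) 0); apply: ler_seqE => u _; apply: exprn_ge0.
    - by case: (bad _); rewrite /= ?expr0 ?expr1; lra.
  rewrite seqEZ seqED seqE_cst // seqEZ exprSr ler_wpM2l ?exprn_ge0 //.
  apply: (@le_trans _ _ (1 + 15 * (1 / 16))); last by lra.
  by rewrite lerD2l ler_pM2l //; exact: seqE_mean_bad.
have h4 : 0 < 4 ^+ G :> R by rewrite exprn_gt0.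
apply: (@le_trans _ _ (seqE (G * s) (fun w => 4 ^- G *
    16 ^+ count bad (group_means G s (map f w))))).
  apply: ler_seqE => w _; case: leqP => hG; last by rewrite mulr_ge0 ?invr_ge0 ?exprn_ge0.
  rewrite mulrC ler_pdivlMr // mul1r.
  rewrite (_ : 16 = 4 ^+ 2 :> R); last by ring.
  by rewrite -exprM ler_weXn2l //; lra.
rewrite seqEZ mulrC ler_pdivrMr //; apply: le_trans (mgf G) _.
rewrite (_ : 4 = 2 * 2 :> R); last by ring.
by rewrite exprMn mulKf // expf_neq0.
Qed.

End MedianOfMeans.

(** * Deflation by random directions *)

Section Deflation.
Context {R : rcfType} {n : nat}.
Variable B : 'M[R]_n.
Implicit Types (P : 'M[R]_n) (x z : 'cV[R]_n) (g : {ffun 'I_n -> bool}).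

(** The added term is the orthogonal projection onto the line of [z], and 0 if [z = 0]. *)
Definition add_dir P z : 'M[R]_n := P + (ip z z)^-1 *: (z *m z^T).

Definition deflate_step P x : 'M[R]_n := add_dir P ((1%:M - P) *m (B *m x)).

Definition residual P : R := ip ((1%:M - P) *m B) ((1%:M - P) *m B).

Lemma residual_ge0 P : 0 <= residual P. Proof. exact: ip_ge0. Qed.

Lemma dirM z : (ip z z)^-1 *: (z *m z^T) *m z = z.
Proof.
rewrite -scalemxAl -mulmxA mulmx_trip mul_mx_scalar scalerA.
have [z0|z0] := eqVneq (ip z z) 0; first by rewrite (ip_eq0 z0) scaler0.
by rewrite mulVf // scale1r.
Qed.

Lemma dir_proj z : is_proj ((ip z z)^-1 *: (z *m z^T)).
Proof.
split; first by rewrite linearZ /= trmx_mul trmxK.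
by rewrite -scalemxAr mulmxA dirM.
Qed.

Lemma add_dir_proj P z : is_proj P -> P *m z = 0 -> is_proj (add_dir P z).
Proof.
move=> [sP iP] Pz; have [sD iD] := dir_proj z; split.
  by rewrite linearD /= sP sD.
have zP : z^T *m P = 0 by rewrite -[P]sP -trmx_mul Pz trmx0.
rewrite /add_dir mulmxDl !mulmxDr iP iD -scalemxAr mulmxA Pz mul0mx scaler0 addr0.
by rewrite -!scalemxAl -mulmxA zP mulmx0 scaler0 add0r.
Qed.

Lemma mulmx_projC (p : nat) P (A : 'M[R]_(n, p)) :
  is_proj P -> P *m ((1%:M - P) *m A) = 0.
Proof. by move=> [_ iP]; rewrite mulmxA mulmxBr mulmx1 iP subrr mul0mx. Qed.

Lemma deflate_step_proj P x : is_proj P -> is_proj (deflate_step P x).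
Proof. by move=> hP; apply: add_dir_proj => //; exact: mulmx_projC. Qed.

Lemma residual_step P x (C := (1%:M - P) *m B) (M := C^T *m C) : is_proj P ->
  residual (deflate_step P x) =
  residual P - ip (M *m x) (M *m x) / ip (C *m x) (C *m x).
Proof.
move=> hP; rewrite /residual /deflate_step mulmxA -/C; set z := C *m x.
have [sQ iQ] := is_projC hP.
pose D := (ip z z)^-1 *: (z *m z^T); have [sD iD] : is_proj D := dir_proj z.
have hD : ip (D *m C) (D *m C) = ip C (D *m C) by rewrite ipMl sD mulmxA iD.
(* As [z] is orthogonal to the range of [P], projecting [B] onto its line is the same as projecting
   [C]. *)
have Qz : (1%:M - P) *m z = z by rewrite /z /C !mulmxA iQ.
have -> : (1%:M - add_dir P z) *m B = C - D *m C.
  rewrite /add_dir opprD addrA mulmxBl; congr (_ - _).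
  rewrite /D -!scalemxAl; congr (_ *: _); rewrite -!mulmxA; congr (_ *m _).
  by rewrite -[in LHS]Qz trmx_mul sQ /C -mulmxA.
rewrite ipDl !ipDr !ipNl !ipNr hD (ipC (D *m C)).
suff -> : ip C (D *m C) = ip (M *m x) (M *m x) / ip z z by ring.
rewrite /D -scalemxAl ipZr mulrC -mulmxA; congr (_ / _).
have -> : ip C (z *m (z^T *m C)) = ip (z^T *m C) (z^T *m C).
  by rewrite [RHS]ipMl trmxK.
have -> : M *m x = C^T *m z by rewrite /M -mulmxA.
have -> : z^T *m C = (C^T *m z)^T by rewrite [RHS]trmx_mul trmxK.
by rewrite /ip trmxK mxtrace_mulC.
Qed.

Lemma residual_step_le P x : is_proj P -> residual (deflate_step P x) <= residual P.
Proof.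
by move=> hP; rewrite residual_step // gerDl oppr_le0 divr_ge0 ?ip_ge0.
Qed.

Variable N : R.
Hypotheses (N_gt0 : 0 < N) (B_le : dual_le B N).

(* With x := F / (48 N^2) a successful step gives x' <= x - x^2, so that
   x j <= 1 implies x' (j + 1) <= 1. *)
Lemma deflate_step_success P (j : nat) : is_proj P ->
  residual P * j%:R <= 48 * N ^+ 2 ->
  1 / 24 <= avg (fun g =>
    (residual (deflate_step P (signs g)) * j.+1%:R <= 48 * N ^+ 2)%R%:R : R).
Proof.
move=> hP hj; have N2 : 0 < N ^+ 2 by rewrite exprn_gt0.
have [F0|F_neq0] := eqVneq (residual P) 0.
  apply: (@le_trans _ _ (avg (fun g : {ffun 'I_n -> bool} => 1 : R))).
    by rewrite avg_cst ?card_signs_gt0 //; lra.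
  apply: ler_avg => g; rewrite ler1n lt0b.
  have := residual_step_le (signs g) hP; rewrite F0 => F'0.
  have -> : residual (deflate_step P (signs g)) = 0.
    by apply/eqP; rewrite eq_le F'0 residual_ge0.
  by rewrite mul0r mulr_ge0 // ltW.
have F_gt0 : 0 < residual P by rewrite lt0r F_neq0 residual_ge0.
apply: le_trans (gram_step_prob F_gt0) _; apply: ler_avg => g.
case: andP => [[hZ hW]|_] /=; last by rewrite ler0n.
rewrite ler1n lt0b residual_step //.
have := dual_le_schatten (dual_le_proj (is_projC hP) B_le).
move: hZ hW F_gt0 hj; rewrite /residual.
set C := (1%:M - P) *m B; set M := C^T *m C.
set Z := ip (M *m _) _; set W := ip (C *m _) _.
move: (ip C C) (ip M M) => F G hZ hW F_gt0 hj hG.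
have G_gt0 : 0 < G.
  rewrite -(pmulr_rgt0 _ N2); apply: lt_le_trans hG; exact: exprn_gt0.
have W_gt0 : 0 < W.
  rewrite lt0r ip_ge0 andbT; apply: contraTneq hZ => /ip_eq0 W0.
  by rewrite -ltNge /Z /M -mulmxA W0 mulmx0 ip0l divr_gt0.
(* From Z >= G/2, W <= 24F and F^3 <= N^2 G: Z/W >= G/(48F) >= F^2/(48N^2). *)
have ZW : F ^+ 2 / (48 * N ^+ 2) <= Z / W.
  rewrite ler_pdivlMr // mulrAC ler_pdivrMr ?mulr_gt0 //.
  apply: (@le_trans _ _ (F ^+ 2 * (24 * F))); first by rewrite ler_pM2l ?exprn_gt0.
  apply: (@le_trans _ _ (24 * (N ^+ 2 * G))).
    by rewrite (_ : F ^+ 2 * (24 * F) = 24 * F ^+ 3) ?ler_pM2l //; ring.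
  rewrite (_ : 24 * (N ^+ 2 * G) = G / 2 * (48 * N ^+ 2)); last by field.
  by rewrite ler_pM2r // mulr_gt0.
apply: (@le_trans _ _ ((F - F ^+ 2 / (48 * N ^+ 2)) * j.+1%:R)).
  by rewrite ler_wpM2r ?ler0n // lerD2l lerN2.
move: hj; set K := 48 * N ^+ 2 => hj; have K0 : 0 < K by rewrite mulr_gt0.
rewrite -natr1; have := ler0n R j; move: (j%:R : R) hj => r hj r0.
pose t := F / K; have t0 : 0 < t by rewrite divr_gt0.
have tr : t * r <= 1 by rewrite /t mulrAC ler_pdivrMr // mul1r.
have -> : (F - F ^+ 2 / K) * (r + 1) = (t * (1 - t) * (r + 1)) * K.
  by rewrite /t; field; rewrite gt_eqF.
rewrite -[leRHS]mul1r ler_pM2r //; have [t1|t1] := leP t 1.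
  have : 0 <= (1 - t) * (1 - t * r) by rewrite mulr_ge0 ?subr_ge0.
  by have := sqr_ge0 t; lra.
have : 0 <= t * (t - 1) * (r + 1) by apply: mulr_ge0; [apply: mulr_ge0|]; lra.
lra.
Qed.

Definition deflate_seq (gs : seq {ffun 'I_n -> bool}) P : 'M[R]_n :=
  foldl (fun Q g => deflate_step Q (signs g)) P gs.

Lemma deflate_seq_proj gs P : is_proj P -> is_proj (deflate_seq gs P).
Proof.
elim: gs P => [|g gs IH] P hP //=; apply: IH; exact: deflate_step_proj.
Qed.

Lemma residual_seq_le gs P : is_proj P -> residual (deflate_seq gs P) <= residual P.
Proof.
elim: gs P => [|g gs IH] P hP //=.
apply: le_trans (IH _ _) (residual_step_le _ hP); exact: deflate_step_proj.
Qed.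

(** The bound is a potential for [k] successes outstanding and [L] steps left. A success, of
    probability at least 1/24, halves it; a failure does no harm as the residual never grows. Each
    step thus costs a factor of at most 1 - 1/48. *)
Lemma deflate_seq_fail (L k j : nat) P : is_proj P ->
  residual P * j%:R <= 48 * N ^+ 2 ->
  seqE L (fun gs => (48 * N ^+ 2 < residual (deflate_seq gs P) * (j + k)%N%:R)%R%:R : R)
  <= 2 ^+ k * (47 / 48) ^+ L.
Proof.
elim: L k j P => [|L IH] [|k] j P hP hj.
- by rewrite /= addn0 ltNge hj expr0 mulr1.
- rewrite /= expr0 mulr1; apply: (@le_trans _ _ 1); first by rewrite lern1 leq_b1.
  by apply: exprn_ege1; lra.
- apply: (@le_trans _ _ (seqE L.+1 (fun _ : seq {ffun 'I_n -> bool} => 0 : R))); last first.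
    by rewrite seqE_cst ?card_signs_gt0 // mulr_ge0 ?exprn_ge0 //; lra.
  apply: ler_seqE => gs _; rewrite addn0 lern0 eqb0 -leNgt.
  by apply: le_trans hj; rewrite ler_wpM2r ?ler0n // residual_seq_le.
rewrite [seqE _ _]/=.
pose ok g := residual (deflate_step P (signs g)) * j.+1%:R <= 48 * N ^+ 2.
apply: (@le_trans _ _ (avg (fun g => 2 ^+ k.+1 * (47 / 48) ^+ L +
    - (2 ^+ k * (47 / 48) ^+ L) * (ok g)%:R))).
  apply: ler_avg => g; have hP' := deflate_step_proj (signs g) hP.
  rewrite /deflate_seq /= -/(deflate_seq _ _).
  have [okg|_] := boolP (ok g).
    have := IH k j.+1 _ hP' okg; rewrite addSnnS => h; apply: le_trans h _.
    by rewrite mulr1 exprS; lra.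
  rewrite mulr0 addr0; apply: IH => //.
  by apply: le_trans hj; rewrite ler_wpM2r ?ler0n // residual_step_le.
rewrite avgD avg_cst ?card_signs_gt0 // avgZ !exprS.
pose p : R := avg (fun g => (ok g)%:R).
have p_ge : 1 / 24 <= p by exact: deflate_step_success hP hj.
have c0 : 0 <= 2 ^+ k * (47 / 48) ^+ L :> R by rewrite mulr_ge0 ?exprn_ge0 //; lra.
have := ler_wpM2l c0 p_ge; rewrite -/p; lra.
Qed.

Lemma half_pow48 : (47 / 48) ^+ 48 <= 1 / 2 :> R.
Proof. lra. Qed.

End Deflation.

(** * Trace estimation for one matrix *)

(** Programs that query one fixed matrix; the online algorithm later simulates that matrix by two of
    the inputs. *)
Inductive oracle_prog (R : Type) (n : nat) : Type :=
| Ret of R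
| Ask of 'cV[R]_n & ('cV[R]_n -> oracle_prog R n).

Arguments Ret {R n}.

Section Programs.
Context {R : rcfType} {n : nat}.
Implicit Types (p : oracle_prog R n) (P : 'M[R]_n).
Local Notation seed := {ffun 'I_n -> bool}.

Fixpoint prog_run (B : 'M[R]_n) p : R :=
  match p with
  | Ret t => t
  | Ask x next => prog_run B (next (B *m x))
  end.

Fixpoint prog_cost (B : 'M[R]_n) p : nat :=
  match p with
  | Ret _ => 0
  | Ask x next => (prog_cost B (next (B *m x))).+1
  end.

(** The second query of each step pays for the trace on the new direction, so that a run started
    from [P = 0] and [acc = 0] keeps [acc] equal to [\tr (B *m P)]. *)
Fixpoint deflate_prog (gs : seq seed) P (acc : R)
    (next : 'M[R]_n -> R -> oracle_prog R n) : oracle_prog R n :=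
  if gs is g :: gs' then
    Ask (signs g) (fun y => let z := (1%:M - P) *m y in
      Ask z (fun u => deflate_prog gs' (add_dir P z) (acc + ip z u / ip z z) next))
  else next P acc.

Fixpoint quad_prog (xs : seq 'cV[R]_n) (vals : seq R)
    (next : seq R -> oracle_prog R n) : oracle_prog R n :=
  if xs is x :: xs' then
    Ask x (fun y => quad_prog xs' (rcons vals (ip x y)) next)
  else next vals.

(* k: target rank of the deflation; G, s: number and size of the groups. *)
Definition trace_prog (k G s : nat) (tau : R) (w : seq seed) : oracle_prog R n :=
  let L := (48 * (k + G))%N in
  deflate_prog (take L w) 0 0 (fun P acc =>
    quad_prog [seq (1%:M - P) *m signs h | h <- take (G * s) (drop L w)] [::]
      (fun vals => Ret (acc + majority_center tau (group_means G s vals)))).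

Variable B : 'M[R]_n.

Lemma trace_add_dir P z :
  \tr (B *m add_dir P z) = \tr (B *m P) + ip z (B *m z) / ip z z.
Proof.
rewrite /add_dir mulmxDr raddfD /= -scalemxAr linearZ /= mulmxA.
by rewrite [\tr (_ *m z^T)]mxtrace_mulC mulrC.
Qed.

Lemma deflate_progE gs P acc next :
  let P' := deflate_seq B gs P in
  let acc' := acc + \tr (B *m P') - \tr (B *m P) in
  (prog_run B (deflate_prog gs P acc next) = prog_run B (next P' acc')) *
  (prog_cost B (deflate_prog gs P acc next) =
    2 * size gs + prog_cost B (next P' acc'))%N.
Proof.
elim: gs P acc => [|g gs IH] P acc /=; first by rewrite addrK muln0.
set z := (1%:M - P) *m _; rewrite !IH /= -/(deflate_seq _ _ _).
have -> : deflate_step B P (signs g) = add_dir P z by [].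
set acc1 := _ + _ - _; set acc2 := _ + _ - _.
have -> : acc1 = acc2; last by rewrite mulnS.
by rewrite /acc1 /acc2 trace_add_dir; ring.
Qed.

Lemma quad_progE xs vals next :
  let vals' := vals ++ [seq ip x (B *m x) | x <- xs] in
  (prog_run B (quad_prog xs vals next) = prog_run B (next vals')) *
  (prog_cost B (quad_prog xs vals next) = size xs + prog_cost B (next vals'))%N.
Proof.
elim: xs vals => [|x xs IH] vals /=; first by rewrite cats0.
by rewrite !IH /= cat_rcons addSn.
Qed.

Definition compress P : 'M[R]_n := (1%:M - P) *m B *m (1%:M - P).

Lemma quad_compress P h : is_proj P ->
  ip ((1%:M - P) *m signs h) (B *m ((1%:M - P) *m signs h)) = quad (compress P) h.
Proof. by move=> /is_projC[sQ _]; rewrite ipMl sQ /quad /compress !mulmxA. Qed.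

Lemma trace_compress P : is_proj P -> \tr (B *m P) + \tr (compress P) = \tr B.
Proof.
move=> /is_projC[_ iQ]; rewrite /compress [\tr (_ *m B *m _)]mxtrace_mulC mulmxA iQ.
rewrite [\tr (_ *m B)]mxtrace_mulC.
by rewrite -raddfD /= -mulmxDr addrC subrK mulmx1.
Qed.

Lemma compress_le P : is_proj P -> ip (compress P) (compress P) <= residual B P.
Proof.
move=> hP; have [sQ iQ] := is_projC hP; rewrite /residual /compress.
set C := _ *m B; have -> : ip (C *m (1%:M - P)) (C *m (1%:M - P))
  = ip ((1%:M - P) *m C^T) ((1%:M - P) *m C^T).
  by rewrite -{1 2}sQ -[C]trmxK -!trmx_mul trmxK /ip !trmxK mxtrace_mulC.
apply: le_trans (is_proj_ip _ (is_projC hP)) _.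
by rewrite /ip trmxK mxtrace_mulC.
Qed.

Lemma trace_prog_run k G s tau w (L := (48 * (k + G))%N)
    (P := deflate_seq B (take L w) 0) :
  prog_run B (trace_prog k G s tau w) - \tr B =
  majority_center tau (group_means G s
    [seq quad (compress P) h | h <- take (G * s) (drop L w)]) - \tr (compress P).
Proof.
have hP : is_proj P by apply: deflate_seq_proj; exact: is_proj0.
rewrite /trace_prog deflate_progE quad_progE /= -/L -/P mulmx0 mxtrace0.
rewrite -(trace_compress hP) -map_comp.
rewrite (eq_map (fun h => quad_compress h hP)); ring.
Qed.

Lemma trace_prog_cost k G s tau w :
  (prog_cost B (trace_prog k G s tau w) <= 96 * (k + G) + G * s)%N.
Proof.
rewrite /trace_prog deflate_progE quad_progE /= addn0 size_map.
have := size_take_min (48 * (k + G)) w.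
have := size_take_min (G * s) (drop (48 * (k + G)) w).
lia.
Qed.

Variables (N tau : R) (k G s : nat).
Hypotheses (N_gt0 : 0 < N) (B_le : dual_le B N) (tau_gt0 : 0 < tau).
Hypotheses (k_gt0 : (0 < k)%N) (s_gt0 : (0 < s)%N).
Hypothesis ks : 16 * (96 * N ^+ 2) <= k%:R * s%:R * tau ^+ 2.

Lemma trace_prog_fail (K : nat) : (48 * (k + G) + G * s <= K)%N ->
  seqE K (fun w =>
    (2 * tau < `|prog_run B (trace_prog k G s tau w) - \tr B|)%R%:R : R)
  <= 2 * 2 ^- G.
Proof.
set L := (48 * (k + G))%N => LK.
(* The seed splits into the deflation directions, the samples of Hutchinson's estimator and a
   surplus that is averaged out. A failed deflation is charged probability 1 below. *)
rewrite -(subnK LK) addnC -addnA seqE_cat.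
set K' := (K - _)%N.
pose big gs := 48 * N ^+ 2 < residual B (deflate_seq B gs 0) * k%:R.
apply: (@le_trans _ _ (seqE L (fun gs => (big gs)%:R + 2 ^- G))).
  apply: ler_seqE => gs sgs; have [_|small] := boolP (big gs).
    apply: (@le_trans _ _ 1); last by rewrite lerDl invr_ge0 exprn_ge0.
    rewrite -[leRHS](seqE_cst (@card_signs_gt0 n) (G * s + K')).
    by apply: ler_seqE => w _; rewrite lern1 leq_b1.
  rewrite add0r; rewrite /big -leNgt in small.
  pose P := deflate_seq B gs 0.
  have hP : is_proj P by apply: deflate_seq_proj; exact: is_proj0.
  have k0 : 0 < k%:R :> R by rewrite ltr0n.
  (* After a successful deflation the residual is at most 48 N^2 / k, and the variance at most twice
     that. *)
  have var : avg (fun t => (quad (compress P) t - \tr (compress P)) ^+ 2)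
      <= 96 * N ^+ 2 / k%:R.
    apply: le_trans (avg_quad_var _) _.
    rewrite ler_pdivlMr //; have := compress_le hP => h.
    have := ler_wpM2r (ltW k0) h; rewrite -/P in small; lra.
  have sv : 16 * (96 * N ^+ 2 / k%:R) <= s%:R * tau ^+ 2.
    by rewrite mulrA ler_pdivrMr // mulrAC (mulrC s%:R).
  rewrite seqE_cat.
  apply: le_trans (seqE_many_bad (@card_signs_gt0 n) (avg_quad _) var tau_gt0 G s_gt0 sv).
  apply: ler_seqE => hs shs.
  rewrite -[leRHS](seqE_cst (@card_signs_gt0 n) K'); apply: ler_seqE => r _.
  rewrite trace_prog_run -/L take_size_cat // drop_size_cat // take_size_cat // -/P.
  rewrite ler_nat; case: ltP => // + /[!lt0b]; rewrite ltNge.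
  apply: contraNT; rewrite -ltnNge => few.
  by apply: majority_centerP; rewrite size_group_means.
rewrite seqED (seqE_cst (@card_signs_gt0 n)).
have := @deflate_seq_fail _ _ _ _ N_gt0 B_le L k 0 0 (is_proj0 _).
rewrite mulr0 mulr_ge0 ?sqr_ge0 // => /(_ isT).
(* Since 48 steps halve the potential, 48 k of them cancel the factor 2^k and 48 G more leave
   2^-G. *)
have half : 2 ^+ k * (47 / 48) ^+ L <= 2 ^- G :> R.
  rewrite /L exprM; apply: (@le_trans _ _ (2 ^+ k * (1 / 2) ^+ (k + G))).
    rewrite ler_pM2l ?exprn_gt0 // lerXn2r ?nnegrE ?exprn_ge0 ?half_pow48 //; lra.
  by rewrite mul1r exprVn exprD invfM mulVKf // expf_neq0.
rewrite add0n => h; have := le_trans h half; rewrite -/big; lra.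
Qed.

End Programs.

(** * The online algorithm *)

Definition lowbit (i : nat) : nat := (2 ^ logn 2 i)%N.

(* i without its lowest binary digit 1; truncated subtraction gives parent 0 = 0. *)
Definition parent (i : nat) : nat := (i - lowbit i)%N.

Lemma parent_le i : (parent i <= i)%N.
Proof. exact: leq_subr. Qed.

Lemma lowbit_le i : (0 < i)%N -> (lowbit i <= i)%N.
Proof. by move=> i0; apply: dvdn_leq => //; exact: pfactor_dvdnn. Qed.

Lemma parent_lt i : (0 < i)%N -> (parent i < i)%N.
Proof. by move=> i0; rewrite /parent ltn_subrL i0 andbT expn_gt0. Qed.

(** The binary digit of weight 2^v is either 0, or the lowest digit 1 of [i], which [parent]
    clears. *)
Lemma parent_dvdn v i : (0 < i)%N -> (2 ^ v %| i)%N ->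
  (2 ^ v.+1 %| i)%N \/ (2 ^ v.+1 %| parent i)%N.
Proof.
move=> i0 vi; have [|nvi] := boolP (2 ^ v.+1 %| i)%N; [by left | right].
have lv : logn 2 i = v.
  by apply/eqP; rewrite eqn_leq leqNgt -!pfactor_dvdn // nvi vi.
rewrite /parent /lowbit lv; case/dvdnP: vi => q iq; move: nvi; rewrite iq.
rewrite expnS dvdn_pmul2r ?expn_gt0 // dvdn2 negbK => oq.
by rewrite -{3}[(2 ^ v)%N]mul1n -mulnBl dvdn_pmul2r ?expn_gt0 // dvdn2 oddB ?oq // odd_gt0.
Qed.

(** Bound [lowbit i] by the sum of all 2^v dividing [i] with v < L. Each 2^v divides at most m / 2^v
    indices, so each of the L levels contributes at most m. *)
Lemma sum_lowbit L m : (m <= 2 ^ L)%N -> (\sum_(1 <= i < m) lowbit i <= m * L)%N.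
Proof.
move=> mL; apply: (@leq_trans (\sum_(1 <= i < m) \sum_(v < L) 2 ^ v * (2 ^ v %| i))).
  rewrite big_nat_cond [leqRHS]big_nat_cond; apply: leq_sum => i.
  rewrite andbT => /andP[i0 im].
  have lL : (logn 2 i < L)%N.
    rewrite -(ltn_exp2l _ _ (isT : (1 < 2)%N)); apply: leq_trans mL.
    exact: leq_ltn_trans (lowbit_le i0) im.
  by rewrite (bigD1 (Ordinal lL)) //= pfactor_dvdnn muln1 leq_addr.
rewrite exchange_big /=.
apply: (@leq_trans (\sum_(v < L) m)); last by rewrite sum_nat_const card_ord mulnC.
apply: leq_sum => v _; rewrite -big_distrr /=.
suff h : (\sum_(1 <= i < m) (2 ^ v %| i) <= m %/ 2 ^ v)%N.
  by apply: leq_trans (leq_divM m (2 ^ v)); rewrite mulnC leq_mul2r h orbT.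
case: m {mL} => [|m]; first by rewrite big_geq.
rewrite big_add1 /=.
have -> : (\sum_(0 <= i < m) (2 ^ v %| i.+1) = m %/ 2 ^ v)%N.
  elim: m => [|m IH]; first by rewrite big_geq ?div0n.
  by rewrite big_nat_recr //= IH divnS ?expn_gt0 // addnC.
by apply: leq_div2r.
Qed.

Section Online.
Context {R : realType} {n m : nat}.
Implicit Types (i : 'I_m) (p : oracle_prog R n).

Definition parent_ord i : 'I_m :=
  Ordinal (leq_ltn_trans (parent_le i) (ltn_ord i)).

Definition increment (A : 'I_m -> 'M[R]_n) i : 'M[R]_n :=
  if i == 0%N :> nat then A i else A i - A (parent_ord i).

Fixpoint query_increment i p (next : R -> matvec_alg R n m i) : matvec_alg R n m i :=
  match p with
  | Ret t => next t
  | Ask x f =>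
      Query x (leqnn i) (fun y =>
        if i == 0%N :> nat then query_increment (f y) next
        else Query (j := parent_ord i) x (parent_le i) (fun y' =>
          query_increment (f (y - y')) next))
  end.

Lemma query_incrementE A i p (next : R -> matvec_alg R n m i) (B := increment A i) :
  (outputs A (query_increment p next) = outputs A (next (prog_run B p))) *
  (query_count A (query_increment p next) <=
    2 * prog_cost B p + query_count A (next (prog_run B p)))%N.
Proof.
rewrite {}/B; elim: p => [t|x f IH] //=.
have -> : increment A i *m x = if i == 0%N :> nat then A i *m x
    else A i *m x - A (parent_ord i) *m x.
  by rewrite /increment; case: ifP; rewrite ?mulmxBl.
case: ifP => _ /=.
  by have [h1 h2] := IH (A i *m x); split => //; lia.
have [h1 h2] := IH (A i *m x - A (parent_ord i) *m x).
by split => //; rewrite mulnS !addSn !ltnS.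
Qed.

Definition stop_at k (e : (k + 0)%N = m) : matvec_alg R n m k :=
  eq_rect m (matvec_alg R n m) (Stop R n m) k (etrans (esym e) (addn0 k)).

Lemma lt_of_addS k r : (k + r.+1)%N = m -> (k < m)%N.
Proof. by move=> <-; rewrite addnS ltnS leq_addr. Qed.

Lemma addS_shift k r : (k + r.+1)%N = m -> (k.+1 + r)%N = m.
Proof. by rewrite addSnnS. Qed.

(** Recursion on the number [r] of estimates still due; [ts] holds the earlier ones. At [k = 0] the
    list is empty, and the default 0 of [nth] is the intended start of the chain. *)
Fixpoint online (prog : 'I_m -> oracle_prog R n) (r : nat) :
    forall k, (k + r)%N = m -> seq R -> matvec_alg R n m k :=
  match r with
  | 0 => fun k e ts => stop_at e
  | r'.+1 => fun k e ts =>
      let i := Ordinal (lt_of_addS e) in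
      @query_increment i (prog i) (fun v =>
        let t := nth 0 ts (parent k) + v in
        Output t (lt_of_addS e) (online prog (addS_shift e) (rcons ts t)))
  end.

Variables (A : 'I_m -> 'M[R]_n) (prog : 'I_m -> oracle_prog R n).

(** Prepending the past estimates to the future outputs gives a list that does not change as the
    recursion proceeds. *)
Lemma online_nth r k (e : (k + r)%N = m) ts i : size ts = k -> (k <= i)%N ->
  let out := ts ++ outputs A (online prog e ts) in
  nth 0 out i = (if i == 0%N :> nat then 0 else nth 0 out (parent i))
                + prog_run (increment A i) (prog i).
Proof.
elim: r k e ts => [|r IH] k e ts sz ki /=.
  by exfalso; have := ltn_ord i; lia.
rewrite [outputs A _](query_incrementE A _ _).1 /=; set o := Ordinal _; set t := (_ + _).
rewrite -cat_rcons; move: ki; rewrite leq_eqVlt => /predU1P[ki|ki]; last first.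
  by apply: IH => //; rewrite size_rcons sz.
have io : i = o by apply: val_inj; rewrite /= -ki.
set rest := outputs A _.
have -> : nth 0 (rcons ts t ++ rest) i = t.
  by rewrite -ki nth_cat size_rcons sz ltnSn nth_rcons sz ltnn eqxx.
rewrite {1}/t -io; congr (_ + _).
case: eqP => [i0|/eqP i0]; first by rewrite nth_default // sz ki i0.
have pk : (parent i < k)%N by rewrite ki parent_lt // lt0n.
by rewrite nth_cat size_rcons sz ltnS ltnW // nth_rcons sz pk ki.
Qed.

Lemma online_query_count (c : nat -> nat) r k (e : (k + r)%N = m) ts :
  (forall i, (2 * prog_cost (increment A i) (prog i) <= c i)%N) ->
  (query_count A (online prog e ts) <= \sum_(k <= j < m) c j)%N.
Proof.
move=> hc; elim: r k e ts => [|r IH] k e ts /=.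
  by rewrite /stop_at; case: _ / (etrans _ _).
apply: leq_trans (query_incrementE _ _ _).2 _ => /=.
by rewrite [leqRHS]big_ltn ?(lt_of_addS e) // leq_add.
Qed.

Definition online_alg : matvec_alg R n m 0 := online prog (add0n m) [::].

Lemma online_estimate i :
  estimate A online_alg i =
  (if i == 0%N :> nat then 0 else estimate A online_alg (parent_ord i))
  + prog_run (increment A i) (prog i).
Proof. exact: (online_nth (add0n m) (ts := [::])). Qed.

End Online.

(** * Query budget, uniform seeds and the union bound *)

Section QueryBudget.
Context {R : realType}.
Variables (N e : R) (G : nat).

(** This rank k balances the phases: deflation takes about k steps and sampling about G N^2 / (k
    e^2) queries, both of order N sqrt(G) / e up to the additive G. *)
Definition rank_param : nat := (Num.truncn (N * Num.sqrt G%:R / e)).+1.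

Definition group_param : nat :=
  (Num.truncn (64 * 96 * N ^+ 2 / (rank_param%:R * e ^+ 2))).+1.

Hypotheses (N_gt0 : 0 < N) (e_gt0 : 0 < e) (G_gt0 : (0 < G)%N).

Lemma params_variance :
  16 * (96 * N ^+ 2) <= rank_param%:R * group_param%:R * (e / 2) ^+ 2.
Proof.
have k0 : 0 < rank_param%:R :> R by rewrite ltr0n.
have ke : 0 < rank_param%:R * e ^+ 2 by rewrite mulr_gt0 ?exprn_gt0.
have : 64 * 96 * N ^+ 2 / (rank_param%:R * e ^+ 2) < group_param%:R.
  exact: truncnS_gt.
rewrite ltr_pdivrMr //; move: (rank_param%:R : R) (group_param%:R : R) => k s; nra.
Qed.

Lemma params_cost :
  (96 * (rank_param + G) + G * group_param)%N%:R
  <= 65 * 96 * (N * Num.sqrt G%:R / e + G%:R) :> R.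
Proof.
pose x := N * Num.sqrt G%:R / e.
have G1 : 1 <= G%:R :> R by rewrite ler1n.
have r0 : 0 < Num.sqrt G%:R :> R by rewrite sqrtr_gt0 ltr0n.
have x0 : 0 < x by rewrite divr_gt0 // mulr_gt0.
have kx : x < rank_param%:R by exact: truncnS_gt.
have k0 : 0 < rank_param%:R :> R by rewrite ltr0n.
have ke : 0 < rank_param%:R * e ^+ 2 by rewrite mulr_gt0 ?exprn_gt0.
have xk : rank_param%:R <= x + 1.
  by rewrite /rank_param -natr1 lerD2r truncn_le // ltW.
have sk : group_param%:R <= 64 * 96 * N ^+ 2 / (rank_param%:R * e ^+ 2) + 1.
  rewrite /group_param -natr1 lerD2r truncn_le // divr_ge0 ?ltW //.
  by rewrite mulr_gt0 ?exprn_gt0.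
have Gs : G%:R * (64 * 96 * N ^+ 2 / (rank_param%:R * e ^+ 2)) <= 64 * 96 * x.
  rewrite mulrA ler_pdivrMr // -(@sqr_sqrtr _ (G%:R)) ?ler0n //.
  have -> : Num.sqrt G%:R ^+ 2 * (64 * 96 * N ^+ 2)
      = 64 * 96 * x * (x * e ^+ 2).
    by rewrite /x; field; rewrite gt_eqF.
  apply: ler_wpM2l; first by rewrite mulr_ge0 // ltW.
  by rewrite ler_wpM2r ?sqr_ge0 // ltW.
rewrite natrD !natrM natrD -/x.
have := ler_wpM2l (ler0n R G) sk.
move: Gs xk G1; move: (64 * 96 * N ^+ 2 / _) => y.
move: (rank_param%:R : R) (group_param%:R : R) (G%:R : R) (x) => k s g z.
lra.
Qed.

End QueryBudget.

Section UniformMeasure.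
Context {R : realType} (M : nat).

(** For [M > 0] it is uniform on the numbers below [M], used as indices into an enumeration of
    seeds; [\d_0] is only the fallback for zero mass. *)
Definition uniform_nat : probability nat R :=
  mnormalize (msum (fun i => \d_i) M) \d_0%N.

Lemma uniform_natE (S : pred nat) : (0 < M)%N ->
  uniform_nat [set w | S w] = ((\sum_(i < M) (S i)%:R) / M%:R)%:E.
Proof.
move=> M0; rewrite /uniform_nat /= /mnormalize /=.
have e U : msum (fun i => \d_i : measure nat R) M U = (\sum_(i < M) (nat_of_ord i \in U)%:R)%:E.
  by rewrite /msum -sumEFin; apply: eq_bigr => i _; rewrite /= diracE.
have eT : msum (fun i => \d_i : measure nat R) M setT = M%:R%:E.
  rewrite e; under eq_bigr do rewrite in_setT /=.
  by rewrite sumr_const card_ord.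
rewrite eT eqe pnatr_eq0 gtn_eqF //= e -EFinM; congr (_ * _)%:E.
by apply: eq_bigr => i _; congr (_%:R); congr nat_of_bool; apply/asboolP/idP.
Qed.

End UniformMeasure.

Lemma uniform_nat_seqE (R : realType) (T : finType) (K : nat) (t0 : K.-tuple T)
    (S : pred (seq T)) : (0 < #|T|)%N ->
  uniform_nat (#|T| ^ K) [set w | S (nth t0 (enum {: K.-tuple T}) w)]
  = (seqE K (fun s => (S s)%:R : R))%:E.
Proof.
move=> T0; rewrite uniform_natE ?expn_gt0 ?T0 //; congr (_%:E).
rewrite seqE_tuple -card_tuple; congr (_ / _).
rewrite -[RHS]big_enum /= (big_nth t0) big_mkord -cardE.
by apply: eq_bigr => i _.
Qed.

Lemma ln_pow2_le (R : realType) (a : nat) (x : R) : 0 < x -> 2 ^+ a <= x ->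
  a%:R * ln 2 <= ln x.
Proof.
move=> x0 ax; rewrite mulr_natl -lnXn // ler_ln ?posrE ?exprn_gt0 //.
Qed.

Section Bounds.
Context {R : realType}.
Variable m : nat.
Hypothesis m_ge2 : (1 < m)%N.

Let ln2_gt0 : 0 < ln 2 :> R.
Proof. by rewrite ln_gt0 // ltr1n. Qed.

Definition depth : nat := (trunc_log 2 m).+1.

Lemma depth_ln : depth%:R <= 2 / ln 2 * ln m%:R :> R.
Proof.
have m0 : (0 < m)%N by lia.
have h1 := @ln_pow2_le R (trunc_log 2 m) m%:R.
have h2 := @ln_pow2_le R 1 m%:R.
rewrite mulrAC ler_pdivlMr // /depth -natr1 mulrDl mul1r.
have {}h1 : (trunc_log 2 m)%:R * ln 2 <= ln m%:R :> R.
  by apply: h1; rewrite ?ltr0n // -natrX ler_nat trunc_logP.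
have {}h2 : 1%:R * ln 2 <= ln m%:R :> R.
  by apply: h2; rewrite ?ltr0n // ler_nat.
lra.
Qed.

Lemma depth_le : (depth <= m)%N.
Proof.
rewrite /depth; apply: leq_trans (trunc_logP (isT : (1 < 2)%N) (ltnW m_ge2)).
exact: ltn_expl.
Qed.

Variable delta : R.
Hypothesis delta_gt0 : 0 < delta.

(** Chosen so that 2^G > 4 m / delta: a chain has at most 2 m links, each failing with probability
    at most 2 * 2^-G. *)
Definition group_count : nat := (trunc_log 2 (Num.truncn (4 * m%:R / delta))).+1.

Lemma group_count_fail : depth.+1%:R * (2 * 2 ^- group_count) <= delta.
Proof.
have hG : 4 * m%:R / delta < 2 ^+ group_count.
  apply: lt_le_trans (truncnS_gt _) _; rewrite -natrX ler_nat.
  exact: trunc_log_ltn.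
have dm : depth.+1%:R <= 2 * m%:R :> R.
  by rewrite -natrM ler_nat; have := depth_le; lia.
rewrite mulrA ler_pdivrMr ?exprn_gt0 //.
by move: hG; rewrite ltr_pdivrMr //; lra.
Qed.

Hypothesis delta_le1 : delta <= 1.

Let x_ge2 : 2 <= m%:R / delta.
Proof.
rewrite ler_pdivlMr //; apply: (@le_trans _ _ (2 * 1)); first by rewrite ler_pM2l.
by rewrite mulr1 ler_nat.
Qed.

Lemma group_count_ln : group_count%:R <= 4 / ln 2 * ln (m%:R / delta) :> R.
Proof.
set x := m%:R / delta; have x2 : 2 <= x := x_ge2; have x0 : 0 < x by lra.
have x40 : 0 < 4 * x by lra.
have h2 : 1%:R * ln 2 <= ln x by apply: ln_pow2_le.
have h1 : (trunc_log 2 (Num.truncn (4 * x)))%:R * ln 2 <= ln (4 * x).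
  apply: ln_pow2_le => //; apply: (@le_trans _ _ (Num.truncn (4 * x))%:R).
    rewrite -natrX ler_nat trunc_logP // truncn_gt0; lra.
  by rewrite truncn_le ltW.
have h3 : ln (4 * x) = 2 * ln 2 + ln x.
  rewrite lnM ?posrE //; congr (_ + _).
  by rewrite (_ : 4 = 2 ^+ 2) ?lnXn ?mulr_natl //; ring.
rewrite mulrAC ler_pdivlMr // /group_count -mulrA -/x -natr1 mulrDl mul1r; lra.
Qed.

End Bounds.

(** * Norms of the increments and errors along a chain *)

Section Chain.
Context {R : realType} {n m : nat}.

Lemma increment_telescope (A : 'I_m -> 'M[R]_n) (alpha : R) :
  (forall i j : 'I_m, j = i.+1 :> nat -> dual_le (A j - A i) alpha) ->
  forall d (i j : 'I_m), i = (j + d)%N :> nat -> dual_le (A i - A j) (d%:R * alpha).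
Proof.
move=> hA; elim=> [|d IH] i j ij.
  have -> : i = j by apply: val_inj; rewrite /= ij addn0.
  by rewrite subrr mul0r; exact: dual_le0.
have jm : (j.+1 < m)%N by have := ltn_ord i; lia.
have -> : A i - A j = (A i - A (Ordinal jm)) + (A (Ordinal jm) - A j).
  by rewrite addrA subrK.
rewrite -natr1 mulrDl mul1r; apply: dual_leD; first by apply: IH => /=; lia.
exact: hA.
Qed.

Lemma increment_dual (A : 'I_m -> 'M[R]_n) (alpha : R) :
  (forall i : 'I_m, i = 0%N :> nat -> nuclear_norm (A i) <= 1) ->
  (forall i j : 'I_m, j = i.+1 :> nat -> nuclear_norm (A j - A i) <= alpha) ->
  forall i : 'I_m, dual_le (increment A i)
    (if i == 0%N :> nat then 1 else (lowbit i)%:R * alpha).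
Proof.
move=> h0 h1 i; rewrite /increment; case: eqP => [i0|/eqP i0].
  exact/nuclear_norm_dual/h0.
apply: increment_telescope => [k j kj|]; first exact/nuclear_norm_dual/h1.
by rewrite /= /parent subnK // lowbit_le // lt0n.
Qed.

Context {T : finType}.

(* Each step of the chain i, parent i, ... clears the lowest binary digit, so the
   chain has length at most L and a union bound over it suffices. *)
Lemma chain_fail (K L : nat) (D E : 'I_m -> seq T -> R) (e0 e1 beta : R) :
  0 <= e1 -> 0 <= beta ->
  (forall i w, E i w = (if i == 0%N :> nat then 0 else E (parent_ord i) w) + D i w) ->
  (forall i : 'I_m, seqE K (fun w =>
     ((if i == 0%N :> nat then e0 else e1) < `|D i w|)%R%:R : R) <= beta) ->
  forall r v (i : 'I_m), (v + r)%N = L -> (2 ^ v %| i)%N -> (i < 2 ^ L)%N ->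
  seqE K (fun w => (e0 + r%:R * e1 < `|E i w|)%R%:R : R) <= r.+1%:R * beta.
Proof.
move=> e1_ge0 beta_ge0 hE hD; elim=> [|r IH] v i vr vi iL.
all: have zero : i = 0%N :> nat -> forall q : nat,
  seqE K (fun w => (e0 + q%:R * e1 < `|E i w|)%R%:R : R) <= q.+1%:R * beta.
1,3: move=> i0 q; have := hD i; rewrite i0 /= => h;
  apply: (@le_trans _ _ beta); last by rewrite ler_peMl // ler1n.
1,2: apply: le_trans h; apply: ler_seqE => w _; rewrite hE i0 /= add0r ler_nat;
  case: ltP => // h; rewrite lt0b; apply: le_lt_trans h; by rewrite lerDl mulr_ge0.
  (* For [r = 0] the index is below 2^L and divisible by 2^L, hence 0. *)
  apply: zero; move: vi; rewrite -vr addn0 in iL *.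
  by case: (nat_of_ord i) iL => // k kv /(dvdn_leq (ltn0Sn k)); rewrite leqNgt kv.
have [i0|i0] := posnP i; first exact: zero.
have mono : r.+1%:R * beta <= r.+2%:R * beta :> R by rewrite ler_wpM2r // ler_nat.
have [vi'|vp] := parent_dvdn i0 vi.
  apply: le_trans mono; apply: le_trans (IH v.+1 i _ vi' iL); last by lia.
  apply: ler_seqE => w _; rewrite ler_nat; case: ltP => // h; rewrite lt0b.
  by apply: le_lt_trans h; rewrite lerD2l ler_wpM2r // ler_nat.
have pL : (parent_ord i < 2 ^ L)%N by apply: leq_ltn_trans iL; exact: parent_le.
have hp := IH v.+1 (parent_ord i) ltac:(lia) vp pL.
have := hD i; rewrite gtn_eqF // => hi.
rewrite -[r.+2%:R]natr1 mulrDl mul1r; apply: le_trans (lerD hp hi).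
rewrite -seqED; apply: ler_seqE => w _; rewrite hE gtn_eqF //.
rewrite -natrD ler_nat; case: ltP => // h.
case: ltP => // h1; case: ltP => // h2; exfalso; move: h; apply/negP.
rewrite -leNgt; apply: le_trans (ler_normD _ _) _.
by rewrite -natr1 mulrDl mul1r addrA lerD.
Qed.

End Chain.

(** The first matrix alone accounts for queries of order sqrt(log(m/delta)) / eps, however small
    [alpha] is. The lower bound [c] lets the first term of the query bound absorb them, with [C]
    depending on [c]; it also forces m >= 2 and alpha > 0. *)
Theorem theoremB3 (R : realType) (c : R) (c_gt0 : 0 < c) :
  exists C : R, 0 < C /\
  forall (m n : nat) (alpha eps delta : R),
    0 < eps -> 0 < delta -> delta <= 1 ->
    c <= m%:R * alpha * ln m%:R ^+ 2 ->
  exists (d : measure_display) (T : measurableType d) (P : probability T R)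
         (alg : rand_matvec_alg R T n m),
  forall A : 'I_m -> 'M[R]_n,
    (forall i : 'I_m, i = 0%N :> nat -> nuclear_norm (A i) <= 1) ->
    (forall i j : 'I_m, j = i.+1 :> nat ->
       nuclear_norm (A j - A i) <= alpha) ->
    (forall i : 'I_m,
       ((1 - delta)%R%:E <=
        P [set w | (`|estimate A (run_with alg w) i - \tr (A i)| <= eps)%R])%E) /\
    (forall w : T,
       (query_count A (run_with alg w))%:R <=
       C * (m%:R * alpha * ln m%:R ^+ 2 * (Num.sqrt (ln (m%:R / delta)) / eps)
            + m%:R * ln (m%:R / delta))).
Proof.
have ln2_gt0 : 0 < ln 2 :> R by rewrite ln_gt0 // ltr1n.
pose c1 : R := 2 / ln 2; pose c2 : R := 4 / ln 2.
have c1_gt0 : 0 < c1 by rewrite divr_gt0.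
have c2_gt0 : 0 < c2 by rewrite divr_gt0.
have rc2_gt0 : 0 < Num.sqrt c2 by rewrite sqrtr_gt0.
pose K0 : R := 2 * (65 * 96).
have K0_gt0 : 0 < K0 by rewrite !mulr_gt0.
pose a1 : R := Num.sqrt c2 * (2 / c + 2 * c1 ^+ 2).
have a1_gt0 : 0 < a1.
  by rewrite mulr_gt0 // addr_gt0 // ?divr_gt0 // mulr_gt0 // exprn_gt0.
exists (K0 * (a1 + c2)); split; first by rewrite mulr_gt0 // addr_gt0.
move=> m n alpha eps delta eps_gt0 delta_gt0 delta_le1 hc.
have m_ge2 : (1 < m)%N.
  case: m hc => [|[|m]] // hc; exfalso; move: hc.
    by rewrite !mul0r leNgt c_gt0.
  by rewrite ln1 expr0n mulr0 leNgt c_gt0.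
have m_gt0 : 0 < m%:R :> R by rewrite ltr0n ltnW.
have lnm_gt0 : 0 < ln m%:R :> R by rewrite ln_gt0 // ltr1n.
have alpha_gt0 : 0 < alpha.
  have := lt_le_trans c_gt0 hc.
  by rewrite pmulr_lgt0 ?exprn_gt0 // pmulr_rgt0.
pose L := depth m; pose G := group_count m delta.
have L_gt0 : 0 < L%:R :> R by rewrite ltr0n.
(* Error budget: half of [eps] for the first matrix, the other half shared by the at most [L]
   increments of a chain. *)
pose e (i : nat) : R := if i == 0%N then eps / 2 else eps / (2 * L%:R).
pose N (i : nat) : R := if i == 0%N then 1 else (lowbit i)%:R * alpha.
have e_gt0 i : 0 < e i by rewrite /e; case: ifP => _; rewrite divr_gt0 ?mulr_gt0.
have N_gt0 i : 0 < N i.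
  by rewrite /N; case: ifP => _; rewrite ?mulr_gt0 // ltr0n expn_gt0.
pose k i := rank_param (N i) (e i) G; pose s i := group_param (N i) (e i) G.
(* Any length that covers the demand of each index would do, since all of them read prefixes of the
   same seed. *)
pose K := (\sum_(i < m) (48 * (k i + G) + G * s i))%N.
pose prog w (i : 'I_m) : oracle_prog R n := trace_prog (k i) G (s i) (e i / 2) w.
pose seed := {ffun 'I_n -> bool}.
pose t0 : K.-tuple seed := nseq_tuple K [ffun=> true].
pose alg0 (w : nat) := online_alg (prog (nth t0 (enum {: K.-tuple seed}) w)).
have meas (A : 'I_m -> 'M[R]_n) (i : 'I_m) :
  measurable_fun setT (fun w => estimate A (alg0 w) i) by [].
exists _, nat, (uniform_nat (#|{: seed}| ^ K)), (RandMatvecAlg meas).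
move=> A A0 A1; have dualA := increment_dual A0 A1.
split=> [i|w].
  have := @uniform_nat_seqE R _ _ t0
    (fun w => `|estimate A (online_alg (prog w)) i - \tr (A i)| <= eps) card_signs_gt0.
  move=> /= ->; rewrite lee_fin.
  pose E i w := estimate A (online_alg (prog w)) i - \tr (A i).
  pose D i w := prog_run (increment A i) (prog w i) - \tr (increment A i).
  have hE i' w : E i' w =
      (if i' == 0%N :> nat then 0 else E (parent_ord i') w) + D i' w.
    rewrite /E /D online_estimate /increment; case: ifP => _; first by ring.
    by rewrite raddfB /=; ring.
  have hD (i' : 'I_m) : seqE K (fun w =>
      ((if i' == 0%N :> nat then eps / 2 else eps / (2 * L%:R)) < `|D i' w|)%R%:R : R)
      <= 2 * 2 ^- G.
    have sK : (48 * (k i' + G) + G * s i' <= K)%N.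
      by rewrite /K (bigD1 i') //= leq_addr.
    have e2 : 0 < e i' / 2 by rewrite divr_gt0.
    have := trace_prog_fail (N_gt0 i') (dualA i') e2 (ltn0Sn _) (ltn0Sn _)
      (params_variance (N i') G (e_gt0 i')) sK.
    by rewrite mulrC divfK.
  have iL : (i < 2 ^ L)%N by apply: ltn_trans (ltn_ord i) _; exact: trunc_log_ltn.
  have e1 : 0 <= eps / (2 * L%:R) by rewrite ltW // divr_gt0 ?mulr_gt0.
  have b0 : 0 <= 2 * 2 ^- G :> R by rewrite mulr_ge0 ?invr_ge0 ?exprn_ge0.
  have := chain_fail e1 b0 hE hD (add0n L) (dvd1n i) iL.
  have -> : eps / 2 + L%:R * (eps / (2 * L%:R)) = eps by field; rewrite gt_eqF.
  move=> h; have {}h := le_trans h (group_count_fail m_ge2 delta_gt0).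
  rewrite lerBlDr; apply: (@le_trans _ _ (seqE K (fun w : seq seed =>
      (`|E i w| <= eps)%R%:R + (eps < `|E i w|)%R%:R : R))); last first.
    by rewrite seqED lerD2l.
  rewrite -[leLHS](seqE_cst (@card_signs_gt0 n) K); apply: ler_seqE => w _.
  by rewrite ltNge; case: (`|E i w| <= eps); rewrite ?addr0 ?add0r.
have cost : forall i : 'I_m, (2 * prog_cost (increment A i)
    (prog (nth t0 (enum {: K.-tuple seed}) w) i) <=
    2 * (96 * (k i + G) + G * s i))%N.
  by move=> i; rewrite leq_mul2l trace_prog_cost orbT.
have := @online_query_count R n m A _ (fun i => 2 * (96 * (k i + G) + G * s i))%N
  m 0 (add0n m) [::] cost.
rewrite -(ler_nat R) /= => h; apply: le_trans h _.
have G_gt0 : (0 < G)%N by [].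
set Lam := ln (m%:R / delta); set X := m%:R * alpha * ln m%:R ^+ 2.
pose g : R := Num.sqrt G%:R.
(* The 2 belongs to the first matrix. In the other term one factor [L] comes from the sum of the low
   bits, the other from the error budget. *)
have sumN : \sum_(0 <= j < m) N j * g / e j <= g / eps * (2 + 2 * (m%:R * alpha * L%:R ^+ 2)).
  rewrite big_ltn ?(ltnW m_ge2) //.
  have -> : \sum_(1 <= j < m) N j * g / e j
      = (\sum_(1 <= j < m) lowbit j)%N%:R * (alpha * g * (2 * L%:R) / eps).
    rewrite natr_sum mulr_suml big_nat [RHS]big_nat; apply: eq_bigr => j /andP[j0 _].
    rewrite /N /e gtn_eqF //; field.
    by rewrite !gt_eqF.
  have h1 : (\sum_(1 <= j < m) lowbit j)%N%:R <= m%:R * L%:R :> R.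
    rewrite -natrM ler_nat; apply: sum_lowbit; apply: ltnW; exact: trunc_log_ltn.
  have q0 : 0 <= alpha * g * (2 * L%:R) / eps.
    by rewrite divr_ge0 ?mulr_ge0 ?sqrtr_ge0 // ltW.
  have -> : N 0%N * g / e 0%N = g / eps * 2.
    by rewrite /N /e /=; field; rewrite gt_eqF.
  rewrite [leRHS]mulrDr lerD2l; apply: le_trans (ler_wpM2r q0 h1) _.
  by rewrite le_eqVlt; apply/orP; left; apply/eqP; field; rewrite gt_eqF.
have -> : (\sum_(0 <= j < m) 2 * (96 * (k j + G) + G * s j))%N%:R =
    2 * \sum_(0 <= j < m) (96 * (k j + G) + G * s j)%N%:R :> R.
  by rewrite -natr_sum -natrM big_distrr.
apply: (@le_trans _ _ (K0 * (g / eps * (2 + 2 * (m%:R * alpha * L%:R ^+ 2)) + m%:R * G%:R))).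
  rewrite /K0 -mulrA ler_pM2l //.
  apply: (@le_trans _ _ (\sum_(0 <= j < m) 65 * 96 * (N j * g / e j + G%:R))).
    by apply: ler_sum => j _; exact: params_cost.
  rewrite -mulr_sumr ler_pM2l ?mulr_gt0 // big_split /= lerD //.
  by rewrite sumr_const_nat subn0 mulr_natl.
rewrite -[leRHS]mulrA ler_pM2l // mulrDl.
have hL : L%:R <= c1 * ln m%:R := depth_ln m_ge2.
have hG : G%:R <= c2 * Lam := group_count_ln m_ge2 delta_gt0 delta_le1.
have Lam_gt0 : 0 < Lam.
  by rewrite -(pmulr_rgt0 _ c2_gt0); apply: lt_le_trans hG; rewrite ltr0n.
have hg : g <= Num.sqrt c2 * Num.sqrt Lam.
  by rewrite /g -(sqrtrM _ (ltW c2_gt0)) ler_wsqrtr.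
have X_gt0 : 0 < X by apply: lt_le_trans hc.
(* Here X >= c turns the constant 2 into a multiple of X. *)
have hX : 2 + 2 * (m%:R * alpha * L%:R ^+ 2) <= (2 / c + 2 * c1 ^+ 2) * X.
  rewrite [leRHS]mulrDl; apply: lerD.
    by rewrite mulrAC ler_pdivlMr // ler_pM2l.
  have -> : 2 * c1 ^+ 2 * X = 2 * (m%:R * alpha * (c1 * ln m%:R) ^+ 2).
    by rewrite /X; ring.
  rewrite ler_pM2l // ler_pM2l ?mulr_gt0 //.
  by rewrite ler_sqr ?nnegrE // ltW // mulr_gt0.
have hS : g / eps * (2 + 2 * (m%:R * alpha * L%:R ^+ 2)) <= a1 * (X * (Num.sqrt Lam / eps)).
  have -> : a1 * (X * (Num.sqrt Lam / eps)) =
      Num.sqrt c2 * Num.sqrt Lam / eps * ((2 / c + 2 * c1 ^+ 2) * X).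
    by rewrite /a1; ring.
  apply: ler_pM => //.
  - by rewrite divr_ge0 ?sqrtr_ge0 // ltW.
  - by rewrite addr_ge0 // !mulr_ge0 // ?sqr_ge0 ?ltW.
  - by rewrite ler_pM2r // invr_gt0.
have hM : m%:R * G%:R <= c2 * (m%:R * Lam) by rewrite mulrCA ler_pM2l.
have Y0 : 0 <= c2 * (X * (Num.sqrt Lam / eps)).
  by rewrite !mulr_ge0 ?invr_ge0 ?sqrtr_ge0 ?ltW.
have Z0 : 0 <= a1 * (m%:R * Lam).
  exact: mulr_ge0 (ltW a1_gt0) (mulr_ge0 (ltW m_gt0) (ltW Lam_gt0)).
move: hS hM Y0 Z0; rewrite !mulrDr.
move: (g / eps * _) (m%:R * G%:R) => u v; lra.
Qed.
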